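(* Assume that $\mathcal R:\mathcal H\to\mathbb R$ is convex (and Fréchet differentiable). Let $c>0$ and choose $\lambda_k=t_k$ and $M_k=\lceil k/c\rceil$ for all $k\in\mathbb N$. Let $N\in\mathbb N$, let $h_1,\dots,h_N$ be the output sequence of the algorithm FGFD described in the context, with gradient estimates $\hat g_n$ and $g_n=\nabla\mathcal R(h_n)$, and define $\hat h=\big(\sum_{n=1}^N\alpha_n h_n\big)/\sum_{n=1}^N\alpha_n$. Assume $\mathbb E[\|\hat g_n\|_C^2]<+\infty$ for all $n$. Then, for any $h\in C^{1/2}(\mathcal H)$, $$\mathbb E[\mathcal R(\hat h)]-\mathcal R(h)\le \frac{\frac12\|h-h_1\|_C^2}{\sum_{n=1}^N\alpha_n}+(1+2c)\,\frac{\sum_{n=1}^N\alpha_n^2\,\mathbb E[\|g_n\|^2]}{\sum_{n=1}^N\alpha_n}.$$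
   Context: $\mathcal H$ is a real, separable, infinite-dimensional Hilbert space with inner product $\langle\cdot,\cdot\rangle$ and norm $\|\cdot\|$. $\mathcal R:\mathcal H\to\mathbb R$ is Fréchet differentiable, with gradient $\nabla\mathcal R(h)\in\mathcal H$ (Riesz representer of the derivative) and directional derivative $D\mathcal R(h;v)=\langle\nabla\mathcal R(h),v\rangle$. $\mathbb N=\{1,2,\dots\}$. A pre-basis $\{b_1,b_2,\dots\}\subset\mathcal H$ is a linearly independent set with dense span; fix one and let $\{e_1,e_2,\dots\}$ be its Gram–Schmidt orthonormalization (an orthonormal basis of $\mathcal H$). Let $B_k:\mathbb R^k\to\mathcal H$, $B_k x=\sum_{i\le k}x_ib_i$, with QR decomposition $B_k=Q_k\mathbf R_k$, where $Q_kx=\sum_{i\le k}x_ie_i$ and $\mathbf R_k$ is an invertible upper-triangular $k\times k$ matrix. $\mathbb P_K$ is a probability distribution on $\mathbb N$ with infinite support; for $K\sim\mathbb P_K$ put $t_i=\mathbb P[K\ge i]>0$ and $\mathbf T_k=\mathrm{diag}(t_1,\dots,t_k)$. For $k\in\mathbb N$, $\mathbb P_{v\mid k}$ is the law of $v=B_k\mathbf R_k^{-1}\mathbf T_k^{-1/2}\mathbf z$ with $\mathbf z\sim\mathcal N(0,\mathbf I_k)$. Algorithm parameters: a positive bounded real sequence $\{\lambda_k\}_{k\in\mathbb N}$, sample sizes $M_k\in\mathbb N$, learning rates $\alpha_n>0$. Put $\gamma_i=\mathbb E[\lambda_K\mid K\ge i]$ and let $C:\mathcal H\to\mathcal H$ be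 the diagonal operator $Ch=\sum_i\gamma_i\langle e_i,h\rangle e_i$; powers are $C^sh=\sum_i\gamma_i^s\langle e_i,h\rangle e_i$ (possibly unbounded, on their natural domains). $C^{1/2}(\mathcal H)$ is the range of $C^{1/2}$, and for $h\in C^{1/2}(\mathcal H)$, $\|h\|_C^2=\|C^{-1/2}h\|^2=\sum_i\langle h,e_i\rangle^2/\gamma_i$. FGFD algorithm: start from a (deterministic) $h_1\in C^{1/2}(\mathcal H)$. At iteration $n$, independently of the past, sample $K_n\sim\mathbb P_K$; given $K_n=k$, sample $v_1,\dots,v_{M_k}$ i.i.d. from $\mathbb P_{v\mid k}$; set $\hat g_n=\frac{\lambda_k}{M_k}\sum_{m=1}^{M_k}D\mathcal R(h_n;v_m)\,v_m$ and $h_{n+1}=h_n-\alpha_n\hat g_n$. *)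

(* Defs.v *)
From HB Require Import structures.
From mathcomp Require Import all_boot all_order all_algebra.
From mathcomp Require Import all_classical all_reals all_analysis.

Set Implicit Arguments.
Unset Strict Implicit.
Unset Printing Implicit Defensive.

Import Order.TTheory GRing.Theory Num.Theory.
Import numFieldNormedType.Exports.

Local Open Scope classical_set_scope.
Local Open Scope ring_scope.

(* Indexing: the families b, e and the coordinates of R^k are 0-based, so that
   `b i` stands for b_{i+1}; likewise iteration n (n = 0, 1, ...) stands for the
   (n+1)-st iteration.  The values of the random dimension K are the true
   dimensions 1, 2, ..., and so are the indices k of t_k, lambda_k, gamma_k and
   M_k. *)

Section Hilbert.
Context {R : realType} {H : completeNormedModType R}.
Variable ip : {dot H for idfun}.

(* With this identity the complete normed space H is a real Hilbert space. *)
Definition inner_norm : Prop := forall x : H, ip x x = `|x| ^+ 2.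

(* A (countably infinite) pre-basis makes H separable and infinite
   dimensional. *)
Definition prebasis (b : nat -> H) : Prop :=
  (forall (n : nat) (x : 'I_n -> R),
     \sum_(i < n) x i *: b i = 0 -> forall i, x i = 0) /\
  dense [set h : H | exists (n : nat) (x : 'I_n -> R),
                       h = \sum_(i < n) x i *: b i].

Definition gs_next (s : seq H) (x : H) : H :=
  let u := x - \sum_(f <- s) ip f x *: f in `|u|^-1 *: u.

Fixpoint gs_list (b : nat -> H) (n : nat) : seq H :=
  if n is m.+1 then rcons (gs_list b m) (gs_next (gs_list b m) (b m))
  else [::].

Definition gram_schmidt (b : nat -> H) (n : nat) : H :=
  gs_next (gs_list b n) (b n).

Definition synth (b : nat -> H) (k : nat) (x : 'cV[R]_k) : H :=
  \sum_(i < k) x i ord0 *: b i.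

(* The triangular factor of the QR decomposition of `synth b`: since the e_i
   are orthonormal, B_k = Q_k R_k forces (R_k)_{ij} = <e_i, b_j>. *)
Definition qr_R (b : nat -> H) (k : nat) : 'M[R]_k :=
  \matrix_(i < k, j < k) ip (gram_schmidt b i) (b j).

(* Riesz representer of the Frechet derivative. *)
Definition gradient (f : H -> R) (h : H) : H :=
  get [set g : H | forall x : H, 'd (f : H -> R^o) h x = ip g x].

(* Real powers of the diagonal operator h |-> sum_i g_i <e_i, h> e_i. *)
Definition diag_pow_series (e : nat -> H) (g : nat -> R) (s : R) (h : H) :
    nat -> H :=
  series (fun i => ((g i `^ s) * ip (e i) h) *: e i).

Definition diag_pow_dom (e : nat -> H) (g : nat -> R) (s : R) : set H :=
  [set h | cvgn (diag_pow_series e g s h)].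

Definition diag_pow (e : nat -> H) (g : nat -> R) (s : R) (h : H) : H :=
  limn (diag_pow_series e g s h).

End Hilbert.

Section Tail.
Context {R : realType}.
Variable PK : probability nat R.

Definition tail (i : nat) : R := fine (PK [set k | (i <= k)%N]).

Definition cond_mean_tail (lam : nat -> R) (i : nat) : R :=
  fine (\int[PK]_(k in [set k | (i <= k)%N]) (lam k)%:E)%E / tail i.

End Tail.

(* The standard Gaussian distribution N(0, I_k), as the k-fold product of
   N(0, 1) written as an iterated integral. *)
Fixpoint std_normal {R : realType} (k : nat) : set (k.-tuple R) -> \bar R :=
  if k is m.+1 then fun A =>
    (\int[normal_prob 0 1]_(x in [set: R])
       std_normal [set z : m.-tuple R | A (cons_tuple (x : R) z)])%E
  else fun A => (\d_([tuple] : 0.-tuple R) A)%E.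

Section Direction.
Context {R : realType} {H : completeNormedModType R}.
Variables (ip : {dot H for idfun}) (b : nat -> H) (PK : probability nat R).

(* B_k R_k^{-1} T_k^{-1/2} z *)
Definition direction (k : nat) (z : k.-tuple R) : H :=
  synth b (invmx (qr_R ip b k) *m
           diag_mx (\row_(i < k) (tail PK i.+1 `^ (- 2^-1))) *m
           (\col_(i < k) tnth z i)).

Definition direction_law (k : nat) (A : set H) : \bar R :=
  std_normal (@direction k @^-1` A).

End Direction.

Definition borel (T : ptopologicalType) := g_sigma_algebraType (@open T).

Section Algorithm.
Context {R : realType} {H : completeNormedModType R} {d : measure_display}
  {T : measurableType d} {P : probability T R}.
Variables (K : nat -> {RV P >-> nat}) (v : nat -> nat -> {RV P >-> borel H}).
Variable M : nat -> nat.

(* At iteration n only the v n m with m < M k, where k is the value of K n, are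
   sampled; the remaining v n m are left unconstrained. *)
Definition draw (n k : nat) (A : nat -> set H) : set T :=
  [set w | K n w = k /\ forall m, (m < M k)%N -> A m (v n m w)].

(* The events `draw n k A` form a pi-system generating the sigma-algebra of
   iteration n, whence the law of the draw and the independence of different
   iterations are expressed on them. *)
Definition iid_draws (PK : probability nat R)
    (Pv : nat -> set H -> \bar R) : Prop :=
  (forall (n k : nat) (A : nat -> set H), (forall m, <<s @open H >> (A m)) ->
     fine (P (draw n k A)) =
     fine (PK [set k]) * \prod_(m < M k) fine (Pv k (A m))) /\
  (forall (N : nat) (k : nat -> nat) (A : nat -> nat -> set H),
     (forall n m, <<s @open H >> (A n m)) ->
     fine (P (\bigcap_(n in `I_N) draw n (k n) (A n))) =
     \prod_(n < N) fine (P (draw n (k n) (A n)))).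

Variables (lam alpha : nat -> R) (f : H -> R) (h1 : H).

Definition fgfd_step (n : nat) (h : H) (w : T) : H :=
  (lam (K n w) / (M (K n w))%:R) *:
  \sum_(m < M (K n w)) ('D_(v n m w : H) (f : H -> R^o) h : R) *: (v n m w : H).

Fixpoint fgfd (n : nat) (w : T) : H :=
  if n is m.+1 then fgfd m w - alpha m *: fgfd_step m (fgfd m w) w else h1.

Definition fgfd_grad (n : nat) (w : T) : H := fgfd_step n (fgfd n w) w.

End Algorithm.

(* Main.v *)
Require Import Defs.
From HB Require Import structures.
From mathcomp Require Import all_boot all_order all_algebra.
From mathcomp Require Import all_classical all_reals all_analysis.
From mathcomp Require Import measurable_realfun ring lra.
Import Order.TTheory GRing.Theory Num.Theory.
Import numFieldNormedType.Exports.
Local Open Scope classical_set_scope.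
Local Open Scope ring_scope.

(* Let e be the Gram-Schmidt basis, g_n the gradient at h_n, and u_n = h_n - h.  Given K_n = k,
   the i-th coordinate of the estimate is lambda_k / M_k times a quadratic form in independent
   standard normal variables, so Wick's formula gives its first two conditional moments.  As
   gamma_i t_(i+1) is the sum of p_k t_k over k > i, summing over k yields, for u_n
   depending on the past only,
     E[<e_i, ghat_n> <e_i, u_n>] = gamma_i E[<e_i, g_n> <e_i, u_n>],
     sum_(i < L) E[<e_i, ghat_n>^2] / gamma_i <= (1 + 4 c) E|g_n|^2;
   the second one uses t_i / 2 <= gamma_i <= t_i, which makes the fluctuation term of level k at
   most (2 k + 2) / M_k <= 4 c times the sum of the E[<e_j, g_n>^2] / t_(j+1), j < k.
   Expanding the truncated weighted norm sum_(i < L) <e_i, u_n>^2 / gamma_i along one step, adding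
   up over n and letting L tend to infinity (dominated convergence) bounds
   sum_n alpha_n E<g_n, u_n>, and convexity turns this bound into the theorem.  If some E|g_n|^2 is
   infinite, the right-hand side of the theorem is infinite. *)

(** Weighting by the inverse of C is forced: given the past, the estimate has mean C g_n, so the
    factors 1 / gamma_i cancel the gamma_i of the cross term and leave <g_n, u_n>, the quantity that
    convexity controls. No conditional expectation is formed. Independence is granted only for the
    events [draw n k A], and on level k the vectors [v n m] with [m >= M k] are arbitrary. Hence
    every conditional moment is an integral against the indicator of one level, and independence is
    carried from draws to the sigma-algebra [past n] by uniqueness of measures on a pi-system.
    Measurability in H means that of the scalar products with fixed vectors, which survives the
    algebra of the algorithm and reaches the gradient through difference quotients. Expanding the
    square puts a factor 2 before the cross term, so the variance constant 1 + 4 c enters halved, as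
    1/2 + 2 c <= 1 + 2 c. The 4 in 4 c is a product of two factors 2, one from gamma_i >= t_i / 2
    and one from k + 1 <= 2 k. *)

Set Implicit Arguments.
Unset Strict Implicit.
Unset Printing Implicit Defensive.

(** * Calculus of the real inner product *)

Section Inner.
Context {R : realType} {H : completeNormedModType R} (ip : {dot H for idfun}).
Hypothesis ipE : inner_norm ip.
Implicit Types x y z : H.

Lemma ipC x y : ip x y = ip y x.
Proof.
have := @hermitian_subproof _ _ _ _ ip x y.
by rewrite expr0 mul1r.
Qed.

Lemma ipDl x y z : ip (x + y) z = ip x z + ip y z.
Proof. exact: linearDl. Qed.
Lemma ipZl a x z : ip (a *: x) z = a * ip x z.
Proof. exact: linearZl_LR. Qed.
Lemma ipDr x y z : ip x (y + z) = ip x y + ip x z.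
Proof. exact: linearDr. Qed.
Lemma ipZr a x z : ip x (a *: z) = a * ip x z.
Proof. by rewrite ipC ipZl ipC. Qed.
Lemma ipNl x z : ip (- x) z = - ip x z.
Proof. by rewrite -scaleN1r ipZl mulN1r. Qed.
Lemma ipNr x z : ip x (- z) = - ip x z.
Proof. by rewrite ipC ipNl ipC. Qed.
Lemma ip0l z : ip 0 z = 0. Proof. exact: linear0l. Qed.
Lemma ip0r z : ip z 0 = 0. Proof. by rewrite ipC ip0l. Qed.
Lemma ip_suml I (r : seq I) (P : pred I) (F : I -> H) z :
  ip (\sum_(i <- r | P i) F i) z = \sum_(i <- r | P i) ip (F i) z.
Proof. by apply: (big_morph (ip ^~ z)) => [x y|]; rewrite ?ipDl ?ip0l. Qed.
Lemma ip_sumr I (r : seq I) (P : pred I) (F : I -> H) z :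
  ip z (\sum_(i <- r | P i) F i) = \sum_(i <- r | P i) ip z (F i).
Proof. by apply: (big_morph (ip z)) => [x y|]; rewrite ?ipDr ?ip0r. Qed.

Lemma ip_norm x : ip x x = `|x| ^+ 2. Proof. exact: ipE. Qed.

Lemma cauchy_schwarz x y : `|ip x y| <= `|x| * `|y|.
Proof.
have [->|x0] := eqVneq x 0; first by rewrite ip0l !normr0 mul0r.
have nx : 0 < `|x| ^+ 2 by rewrite exprn_gt0// normr_gt0.
rewrite -ler_sqr ?nnegrE ?mulr_ge0// exprMn.
(* Scaling [y] by the square of the norm of [x], instead of dividing the projection by it, keeps the
   expansion polynomial. *)
have : 0 <= ip (`|x|^+2 *: y - ip x y *: x) (`|x|^+2 *: y - ip x y *: x).
  by rewrite ip_norm sqr_ge0.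
rewrite !(ipDl, ipDr, ipNl, ipNr, ipZl, ipZr) !ip_norm (ipC y x).
rewrite real_normK ?num_real//.
set a := `|x| ^+ 2; set b := `|y| ^+ 2; set c := ip x y => h.
have : 0 <= a * (a * b - c ^+ 2) by move: h; lra.
by rewrite pmulr_rge0// subr_ge0.
Qed.

Lemma ip_cvg (I : Type) (F : set_system I) {FF : Filter F} x (u : I -> H) l :
  u @ F --> l -> (ip x (u n)) @[n --> F] --> (ip x l : R).
Proof.
move=> ul; apply/cvgrPdist_lt => e e0.
(* The summand 1 keeps the denominator positive when [x] is 0. *)
have e1 : 0 < e / (1 + `|x|) by rewrite divr_gt0// ltr_pwDl.
move/cvgrPdist_lt : (ul) => /(_ _ e1); apply: filterS => n h.
rewrite -ipNr -ipDr; apply: le_lt_trans (cauchy_schwarz _ _) _.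
have x1 : 0 < 1 + `|x| by rewrite ltr_pwDl.
move: h; rewrite ltr_pdivlMr// => h; apply: le_lt_trans h.
by rewrite mulrC ler_wpM2l// lerDr.
Qed.

Lemma ip_continuous x : continuous (ip x : H -> R).
Proof. by move=> l; apply: (@ip_cvg _ _ _ x id). Qed.

End Inner.

(** * Orthonormal sequences: Bessel, Parseval, Riesz-Fischer, Riesz representation *)

Section Orthonormal.
Context {R : realType} {H : completeNormedModType R} (ip : {dot H for idfun}).
Hypothesis ipE : inner_norm ip.
Context (e : nat -> H).
Implicit Types (x y z : H) (a : nat -> R).

Definition orthonormal_seq := forall i j, ip (e i) (e j) = (i == j)%:R.
Hypothesis eo : orthonormal_seq.

Definition fourier_sum n x : H := \sum_(i < n) ip (e i) x *: e i.

Lemma ip_comb j n a :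
  ip (e j) (\sum_(i < n) a i *: e i) = if (j < n)%N then a j else 0.
Proof.
rewrite ip_sumr; under eq_bigr do rewrite ipZr eo.
case: ifPn => jn.
  rewrite (bigD1 (Ordinal jn))//= eqxx mulr1 big1 ?addr0// => i ij.
  by rewrite (_ : (j == i) = false) ?mulr0//; apply: contraNF ij => /eqP ji; apply/eqP/val_inj.
rewrite big1// => i _; rewrite (_ : (j == i) = false) ?mulr0//.
by apply: contraNF jn => /eqP ->.
Qed.

Lemma ip_comb2 n a y :
  ip (\sum_(i < n) a i *: e i) y = \sum_(i < n) a i * ip (e i) y.
Proof. by rewrite ip_suml; apply: eq_bigr => i _; rewrite ipZl. Qed.

Lemma norm_comb n a : `|\sum_(i < n) a i *: e i| ^+ 2 = \sum_(i < n) a i ^+ 2.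
Proof.
rewrite -(ip_norm ipE) ip_comb2; apply: eq_bigr => i _.
by rewrite ip_comb ltn_ord expr2.
Qed.

Lemma fourier_sumB n x y : fourier_sum n (x - y) = fourier_sum n x - fourier_sum n y.
Proof.
rewrite /fourier_sum -sumrB; apply: eq_bigr => i _.
by rewrite ipDr ipNr scalerBl.
Qed.

Lemma norm_fourier n x : `|fourier_sum n x| ^+ 2 = \sum_(i < n) ip (e i) x ^+ 2.
Proof. exact: (norm_comb n (fun i => ip (e i) x)). Qed.

Lemma fourier_pythagoras n x :
  `|x - fourier_sum n x| ^+ 2 = `|x| ^+ 2 - \sum_(i < n) ip (e i) x ^+ 2.
Proof.
rewrite -(ip_norm ipE) !(ipDl, ipDr, ipNl, ipNr) !(ip_norm ipE) norm_fourier.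
rewrite (ipC _ _ (fourier_sum _ _)).
rewrite (ip_comb2 n (fun i => ip (e i) x)).
under [X in - X]eq_bigr do rewrite -expr2.
lra.
Qed.

Lemma bessel n x : \sum_(i < n) ip (e i) x ^+ 2 <= `|x| ^+ 2.
Proof. by rewrite -subr_ge0 -fourier_pythagoras sqr_ge0. Qed.

(** This bound is uniform in [n], which is what lets [gs_complete] check convergence on a dense set
    only. *)
Lemma norm_sub_fourier n x : `|x - fourier_sum n x| <= `|x|.
Proof.
rewrite -ler_sqr ?nnegrE// fourier_pythagoras gerBl.
by apply: sumr_ge0 => i _; rewrite sqr_ge0.
Qed.

Definition complete_seq := forall x, (fourier_sum n x) @[n --> \oo] --> x.
Hypothesis ec : complete_seq.

Lemma parseval_ip x y :
  (\sum_(i < n) ip (e i) x * ip (e i) y) @[n --> \oo] --> (ip x y : R).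
Proof.
have -> : (fun n => \sum_(i < n) ip (e i) x * ip (e i) y) =
  (fun n => ip y (fourier_sum n x)).
  apply/funext => n; rewrite ipC (ip_comb2 n (fun i => ip (e i) x)).
  by apply: eq_bigr.
rewrite (ipC _ x y).
exact: (ip_cvg ipE).
Qed.

Lemma parseval x : (\sum_(i < n) ip (e i) x ^+ 2) @[n --> \oo] --> (`|x| ^+ 2 : R).
Proof.
have -> : (fun n => \sum_(i < n) ip (e i) x ^+ 2) =
          (fun n => \sum_(i < n) ip (e i) x * ip (e i) x).
  by apply/funext => n; apply: eq_bigr => i _; rewrite expr2.
by rewrite -(ip_norm ipE); exact: parseval_ip.
Qed.

Lemma norm_comb_nat m n a :
  `|\sum_(m <= i < n) a i *: e i| ^+ 2 = \sum_(m <= i < n) a i ^+ 2.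
Proof.
rewrite !big_geq_mkord/= [LHS](_ : _ =
  `|\sum_(i < n) (if (m <= i)%N then a i else 0) *: e i| ^+ 2).
  rewrite (norm_comb n (fun i => if (m <= i)%N then a i else 0)) [RHS]big_mkcond/=.
  by apply: eq_bigr => i _; case: ifP; rewrite ?expr0n.
congr (`|_| ^+ 2); rewrite [LHS]big_mkcond/=.
by apply: eq_bigr => i _; case: ifP; rewrite ?scale0r.
Qed.

(** The squared norm of a block of the series is the same block of the series of squares, so the
    Cauchy property passes from the bounded nondecreasing real sums to the complete space [H]. *)
Lemma riesz_fischer (a : nat -> R) B :
  (forall n, \sum_(i < n) a i ^+ 2 <= B) ->
  cvgn (fun n => \sum_(i < n) a i *: e i).
Proof.
move=> aB.
have sE (V : normedModType R) (u : nat -> V) :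
    (fun n => \sum_(i < n) u i) = series u.
  by apply/funext => n; rewrite /series/= big_mkord.
have aB2 : cvgn (fun n => \sum_(i < n) a i ^+ 2 : R^o).
  apply: nondecreasing_is_cvgn.
    apply/nondecreasing_seqP => n.
    by rewrite big_ord_recr/= lerDl sqr_ge0.
  by exists B => _ [n _ <-].
rewrite (sE H (fun i => a i *: e i)); apply/cauchy_cvgP/cauchy_seriesP => d d0.
move: aB2; rewrite (sE R^o (fun i => a i ^+ 2)).
move=> /cauchy_cvgP/cauchy_seriesP => /(_ _ (exprn_gt0 2 d0)).
apply: filterS => n /=; rewrite ger0_norm; last first.
  by apply: sumr_ge0 => i _; rewrite sqr_ge0.
by rewrite -norm_comb_nat ltr_sqr ?nnegrE// ltW.
Qed.

Lemma fourier_coord_limit a x i : (fun n => \sum_(i < n) a i *: e i) @ \oo --> x ->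
  ip (e i) x = a i.
Proof.
move=> ax.
have c1 : ip (e i) (\sum_(j < n) a j *: e j) @[n --> \oo] --> (ip (e i) x : R).
  exact: (ip_cvg ipE ax).
have c2 : ip (e i) (\sum_(j < n) a j *: e j) @[n --> \oo] --> (a i : R).
  apply: cvg_near_cst; near=> n.
  by rewrite ip_comb ifT//; near: n; exact: nbhs_infty_gt.
exact: (cvg_unique _ c1 c2).
Unshelve. all: end_near. Qed.

(** The representer is the sum of the [D (e i) *: e i]. On a partial sum [D] takes the value [S],
    the sum of the squares, so [S ^+ 2 <= k ^+ 2 * S]; this bounds [S] and [riesz_fischer] applies.
    Completeness of [e] then gives the identity at every vector. *)
Lemma riesz_representation (D : {linear H -> R^o}) : continuous D ->
  exists g, forall x, D x = ip g x.
Proof.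
move=> cD.
have [k k0 Dk] : exists2 k, 0 < k & forall x, `|D x| <= k * `|x|.
  have /linear_boundedP : bounded_near D (nbhs (0 : H)).
    by apply/linear_bounded_continuous.
  by move=> /pinfty_ex_gt0 [k k0 h]; exists k.
have [g Dg] : exists g : H, (fun n => \sum_(i < n) D (e i) *: e i) @ \oo --> g.
  suff /cvg_ex[g] : cvgn (fun n => \sum_(i < n) D (e i) *: e i) by exists g.
  apply: (@riesz_fischer (fun i => D (e i)) (k ^+ 2)) => n.
  set S := \sum_(i < n) _.
  have SE : S = D (\sum_(i < n) D (e i) *: e i).
    by rewrite linear_sum; apply: eq_bigr => i _; rewrite linearZ/= expr2.
  have S0 : 0 <= S by apply: sumr_ge0 => i _; rewrite sqr_ge0.
  have : S ^+ 2 <= k ^+ 2 * S.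
    rewrite {2}/S -(norm_comb n (fun i => D (e i))) -exprMn.
    by rewrite ler_sqr ?nnegrE ?mulr_ge0// ?(ltW k0)// -[leLHS]ger0_norm// {1}SE.
  have [->|Sn0] := eqVneq S 0; first by rewrite sqr_ge0.
  by rewrite expr2 ler_pM2r// lt_def Sn0.
exists g => x.
have c1 : D (fourier_sum n x) @[n --> \oo] --> (D x : R).
  exact: (cvg_comp _ _ (@ec x) (cD x)).
have c2 : D (fourier_sum n x) @[n --> \oo] --> (ip g x : R).
  have -> : (fun n => D (fourier_sum n x)) =
            (fun n => ip x (\sum_(i < n) D (e i) *: e i)).
    apply/funext => n; rewrite linear_sum ipC (ip_comb2 n (fun i => D (e i))).
    by apply: eq_bigr => i _; rewrite linearZ/= mulrC.
  by rewrite ipC; exact: (ip_cvg ipE).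
exact: (cvg_unique _ c1 c2).
Qed.

End Orthonormal.

(** * Gram-Schmidt basis and QR decomposition of a pre-basis *)

Section GramSchmidt.
Context {R : realType} {H : completeNormedModType R} (ip : {dot H for idfun}).
Hypothesis ipE : inner_norm ip.
Context (b : nat -> H).
Hypothesis pb : prebasis b.
Local Notation e := (gram_schmidt ip b).

Definition gs_residual n : H := b n - \sum_(i < n) ip (e i) (b n) *: e i.

Lemma gs_listE n : gs_list ip b n = [seq e i | i <- iota 0 n].
Proof.
by elim: n => // n IH; rewrite -[in RHS](addn1 n) iotaD map_cat -IH cats1.
Qed.

Lemma gram_schmidtE n : e n = `|gs_residual n|^-1 *: gs_residual n.
Proof.
rewrite {1}/gram_schmidt /gs_next gs_listE big_map.
have -> : iota 0 n = index_iota 0 n by rewrite /index_iota subn0.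
by rewrite big_mkord.
Qed.

(** Coefficients are functions on all of [nat], of which only the first [n] values matter;
    inductions on the length then need no casts between ordinal types. *)
Let inspan n (h : H) := exists x : nat -> R, h = \sum_(i < n) x i *: b i.

Let inspan_sum m n (a : nat -> R) (f : nat -> H) :
  (forall i, (i < m)%N -> inspan n (f i)) -> inspan n (\sum_(i < m) a i *: f i).
Proof.
move=> fs; elim: m fs => [|m IH] fs.
  by exists (fun=> 0); rewrite big_ord0 big1// => i _; rewrite scale0r.
have [x xE] := IH (fun i im => fs i (ltnW im)).
have [y yE] := fs m (ltnSn m).
exists (fun i => x i + a m * y i); rewrite big_ord_recr/= xE yE scaler_sumr.
by rewrite -big_split/=; apply: eq_bigr => i _; rewrite scalerDl scalerA.
Qed.

Let inspan_b n m : (n < m)%N -> inspan m (b n).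
Proof.
move=> nm; exists (fun i => (i == n)%:R).
rewrite (bigD1 (Ordinal nm))//= eqxx scale1r big1 ?addr0// => i ij.
rewrite (_ : (i == n :> nat) = false) ?scale0r//.
by apply: contraNF ij => /eqP ni; apply/eqP/val_inj.
Qed.

Let inspan_widen n m h : (n <= m)%N -> inspan n h -> inspan m h.
Proof.
move=> nm [x ->]; apply: inspan_sum => i im; apply: inspan_b.
exact: leq_trans im nm.
Qed.

Let inspan_e n : inspan n.+1 (e n).
Proof.
elim/ltn_ind: n => n IH.
rewrite gram_schmidtE /gs_residual.
have [x xE] : inspan n.+1 (\sum_(i < n) ip (e i) (b n) *: e i).
  apply: (inspan_sum (fun i => ip (e i) (b n))) => i im.
  by apply: inspan_widen (IH _ im); exact: leq_trans im _.
have [y yE] := inspan_b (ltnSn n).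
have rE : b n - \sum_(i < n) ip (e i) (b n) *: e i =
    \sum_(i < n.+1) (y i - x i) *: b i.
  by rewrite xE yE -sumrB; apply: eq_bigr => i _; rewrite scalerBl.
exists (fun i => `|b n - \sum_(i < n) ip (e i) (b n) *: e i|^-1 * (y i - x i)).
by rewrite {2}rE scaler_sumr; apply: eq_bigr => i _; rewrite scalerA.
Qed.

(** A zero residual would place [b n] in the span of its predecessors, a linear relation whose
    coefficient at [n] is 1. *)
Lemma gs_residual_neq0 n : gs_residual n != 0.
Proof.
apply/negP => /eqP r0.
have [x xE] : inspan n (\sum_(i < n) ip (e i) (b n) *: e i).
  apply: (inspan_sum (fun i => ip (e i) (b n))) => i im.
  by apply: inspan_widen (inspan_e i).
have /= := pb.1 n.+1 (fun i => if (i == n :> nat) then 1 else - x i).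
rewrite big_ord_recr/= eqxx scale1r => /(_ _ ord_max)/=; rewrite eqxx.
have : (1 : R) = 0 -> False by move/eqP; rewrite oner_eq0.
move=> + h; apply; apply: h.
rewrite -[RHS]r0 /gs_residual xE addrC -sumrN; congr (_ + _).
by apply: eq_bigr => i _; rewrite ltn_eqF// scaleNr.
Qed.

Lemma gs_orthonormal : orthonormal_seq ip e.
Proof.
suff h n : forall i j, (i < n)%N -> (j < n)%N -> ip (e i) (e j) = (i == j)%:R.
  by move=> i j; apply: (h (maxn i j).+1); rewrite ltnS ?leq_maxl ?leq_maxr.
elim: n => // n IH i j.
have un : ip (e n) (e n) = 1.
  rewrite (ip_norm ipE) gram_schmidtE normrZ normfV normr_id mulVf ?expr1n//.
  by rewrite normr_eq0 gs_residual_neq0.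
have on k : (k < n)%N -> ip (e k) (e n) = 0.
  move=> kn; rewrite (gram_schmidtE n) ipZr /gs_residual ipDr ipNr ip_sumr.
  have -> : \sum_(i < n) ip (e k) (ip (e i) (b n) *: e i) =
            \sum_(i < n) ip (e i) (b n) * (k == i)%:R.
    by apply: eq_bigr => l _; rewrite ipZr IH.
  rewrite [X in _ * (_ - X)](bigD1 (Ordinal kn))//= eqxx mulr1.
  rewrite [X in _ * (_ - (_ + X))]big1.
    by rewrite addr0 subrr mulr0.
  move=> l lk; rewrite (_ : (k == l) = false) ?mulr0//.
  by apply: contraNF lk => /eqP kl; apply/eqP/val_inj.
rewrite !ltnS leq_eqVlt => /orP[/eqP->|ni]; rewrite leq_eqVlt => /orP[/eqP->|nj].
- by rewrite eqxx.
- by rewrite ipC on// gtn_eqF.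
- by rewrite on// ltn_eqF.
- exact: IH.
Qed.

(** This is B_k = Q_k R_k, column by column: the coefficient of [e n] in [b n] is the norm of the
    residual, and the coefficients beyond [n] vanish by orthonormality. *)
Lemma prebasis_expansion n k : (n < k)%N ->
  b n = \sum_(i < k) ip (e i) (b n) *: e i.
Proof.
move=> nk.
have bE : b n = \sum_(i < n.+1)
    (if (i < n)%N then ip (e i) (b n) else `|gs_residual n|) *: e i.
  rewrite big_ord_recr/= ltnn gram_schmidtE scalerA divff ?normr_eq0 ?gs_residual_neq0//.
  rewrite scale1r /gs_residual [X in X + _](_ : _ = \sum_(i < n) ip (e i) (b n) *: e i).
    by rewrite addrC subrK.
  by apply: eq_bigr => i _; rewrite ltn_ord.
pose c i := if (i < n)%N then ip (e i) (b n) else `|gs_residual n|.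
have cE i : ip (e i) (b n) = if (i < n.+1)%N then c i else 0.
  by rewrite {1}bE (ip_comb gs_orthonormal i n.+1 c).
rewrite {1}bE (big_ord_widen k (fun i => c i *: e i))// big_mkcond/=.
by apply: eq_bigr => i _; rewrite cE; case: ifP; rewrite ?scale0r.
Qed.

(** A finite combination [y] of the [b i] near [x] is fixed by all long Fourier sums, so the error
    at [x] equals the error at [x - y], which is at most the norm of [x - y]. *)
Lemma gs_complete : complete_seq ip e.
Proof.
move=> x; apply/cvgrPdist_lt => d d0.
have [y [xy [m [a yE]]]] : exists y, ball x d y /\
    exists (n : nat) (a : 'I_n -> R), y = \sum_(i < n) a i *: b i.
  have [y [xy ?]] := pb.2 (ball x d) (ex_intro _ x (ballxx x d0)) (ball_open x d).
  by exists y.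
near=> n.
have mn : (m <= n)%N by near: n; exact: nbhs_infty_ge.
have yy : fourier_sum ip e n y = y.
  rewrite yE /fourier_sum.
  under eq_bigr do rewrite ip_sumr scaler_suml.
  rewrite exchange_big/=; apply: eq_bigr => i _.
  rewrite {2}(@prebasis_expansion i n) ?(leq_trans (ltn_ord i))// scaler_sumr.
  by apply: eq_bigr => j _; rewrite ipZr [RHS]scalerA.
have -> : x - fourier_sum ip e n x = (x - y) - fourier_sum ip e n (x - y).
  by rewrite fourier_sumB yy opprB addrA subrK.
apply: le_lt_trans (norm_sub_fourier ipE gs_orthonormal _ _) _.
by move: xy; rewrite -ball_normE.
Unshelve. all: end_near. Qed.

(** Through [prebasis_expansion], a kernel vector of R_k is a linear relation between the [b i].
    Transposing only produces the row vector that [det0P] speaks of. *)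
Lemma qr_unit k : qr_R ip b k \in unitmx.
Proof.
suff h : \det (qr_R ip b k) != 0 by rewrite unitmxE unitfE.
rewrite -det_tr.
apply/det0P => -[w w0 wR].
have /pb.1 w00 : \sum_(i < k) w ord0 i *: b i = 0.
  under eq_bigr => i _ do rewrite (@prebasis_expansion i k)// scaler_sumr.
  rewrite exchange_big/= big1// => i _.
  under eq_bigr => j _ do rewrite scalerA.
  rewrite -scaler_suml.
  have := congr1 (fun M : 'rV_k => M ord0 i) wR; rewrite !mxE => h.
  rewrite [X in X *: _](_ : _ = 0) ?scale0r// -[RHS]h.
  by apply: eq_bigr => j _; rewrite !mxE.
by move/eqP: w0; apply; apply/rowP => i; rewrite mxE w00.
Qed.

Lemma synth_qr k (x : 'cV[R]_k) :
  synth b (invmx (qr_R ip b k) *m x) = \sum_(i < k) x i ord0 *: e i.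
Proof.
set y := invmx _ *m x.
have -> : x = qr_R ip b k *m y by rewrite /y mulmxA mulmxV ?qr_unit// mul1mx.
rewrite /synth.
under eq_bigr => i _ do rewrite (@prebasis_expansion i k)// scaler_sumr.
rewrite exchange_big/=; apply: eq_bigr => i _.
rewrite mxE scaler_suml; apply: eq_bigr => j _.
by rewrite scalerA [qr_R _ _ _ _ _]mxE mulrC.
Qed.

End GramSchmidt.

(** * Change of variables under a weight *)

Section Density.
Import HBNNSimple.
Local Open Scope ereal_scope.
Context d1 d2 (X : measurableType d1) (Y : measurableType d2) (R : realType).
Context (mu : {measure set X -> \bar R}) (nu : {measure set Y -> \bar R}).

(* [w nu] is the image under [Z] of the measure with density [W]. *)
Lemma ge0_integral_density (W : X -> R) (Z : X -> Y) (w : R) :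
  measurable_fun setT W -> (forall x, 0 <= W x)%R -> measurable_fun setT Z -> (0 <= w)%R ->
  (forall A, measurable A -> \int[mu]_x (W x * \1_A (Z x))%:E = w%:E * nu A) ->
  forall psi : Y -> R, measurable_fun setT psi -> (forall y, 0 <= psi y)%R ->
  \int[mu]_x (W x * psi (Z x))%:E = w%:E * \int[nu]_y (psi y)%:E.
Proof.
move=> mW W0 mZ w0 WA psi mpsi psi0.
have mpsi' : measurable_fun setT (EFin \o psi) by exact/measurable_EFinP.
pose f := nnsfun_approx measurableT mpsi'.
have mcomp (h : Y -> R) : measurable_fun setT h ->
    measurable_fun setT (fun x => (W x * h (Z x))%:E).
  move=> mh; apply/measurable_EFinP; apply: measurable_funM => //.
  exact: measurableT_comp.
(* For a simple [f n] both sides are linear combinations of the case of indicators, which is the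
   hypothesis [WA]; monotone convergence on either side then reaches [psi]. *)
have fE n : \int[mu]_x (W x * f n (Z x))%:E = w%:E * \int[nu]_y (f n y)%:E.
  have fnE y : (f n y)%:E = \sum_(r \in range (f n)) (r * \1_(f n @^-1` [set r]) y)%:E.
    by rewrite fimfunE -fsumEFin.
  have i0 r y : (0 <= r * \1_(f n @^-1` [set r]) y)%R.
    by rewrite -lee_fin EFinM nnfun_muleindic_ge0.
  under eq_integral => x _.
    rewrite EFinM fnE ge0_mule_fsumr; last first.
      by move=> r; rewrite lee_fin i0.
    over.
  under [in RHS]eq_integral => y _ do rewrite fnE.
  rewrite ge0_integral_fsum//; last 2 first.
  - move=> r; apply: (mcomp (fun y => r * \1_(f n @^-1` [set r]) y)%R).
    by apply: measurable_funM => //; exact: measurable_indic.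
  - by move=> r x _; rewrite lee_fin mulr_ge0// i0.
  rewrite ge0_integral_fsum//; last 2 first.
  - move=> r; apply/measurable_EFinP.
    by apply: measurable_funM => //; exact: measurable_indic.
  - by move=> r x _; rewrite lee_fin i0.
  rewrite ge0_mule_fsumr; last first.
    by move=> r; apply: integral_ge0 => y _; rewrite lee_fin i0.
  apply: eq_fsbigr => r; rewrite inE => -[y _ <-].
  have : measurable (f n @^-1` [set f n y]) by exact: measurable_sfunP.
  move: (f n @^-1` _) => A mA.
  rewrite (eq_integral (fun x => (f n y)%:E * (W x * \1_A (Z x))%:E)); last first.
    by move=> x _; rewrite -EFinM mulrCA.
  rewrite ge0_integralZl//; last 3 first.
  - exact/mcomp/measurable_indic.
  - by move=> x _; rewrite lee_fin mulr_ge0.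
  - by rewrite lee_fin.
  rewrite WA//.
  under [in RHS]eq_integral do rewrite EFinM.
  rewrite ge0_integralZl//; last 2 first.
  - by apply/measurable_EFinP; exact: measurable_indic.
  - by rewrite lee_fin.
  by rewrite integral_indic// setIT muleCA.
have L y : (f n y)%:E @[n --> \oo] --> (psi y)%:E.
  by apply: (cvg_nnsfun_approx measurableT mpsi') => // z _; rewrite lee_fin.
have ndf y m n : (m <= n)%N -> (f m y <= f n y)%R.
  by move=> mn; have /lefP := nd_nnsfun_approx measurableT mpsi' mn; exact.
have h1 : \int[mu]_x (W x * f n (Z x))%:E @[n --> \oo] --> \int[mu]_x (W x * psi (Z x))%:E.
  have -> : \int[mu]_x (W x * psi (Z x))%:E = \int[mu]_x limn (fun n => (W x * f n (Z x))%:E).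
    apply: eq_integral => x _; apply/esym/cvg_lim => //.
    exact: (@cvgeZl _ _ _ _ _ (W x)%:E isT (L (Z x))).
  apply: (cvg_monotone_convergence measurableT (g' := fun n x => (W x * f n (Z x))%:E)) => //.
  - by move=> n; exact: mcomp.
  - by move=> n x _; rewrite lee_fin mulr_ge0.
  - by move=> x _ m n mn; rewrite lee_fin ler_wpM2l// ndf.
have h2 : \int[mu]_x (W x * f n (Z x))%:E @[n --> \oo] --> w%:E * \int[nu]_y (psi y)%:E.
  under eq_cvg do rewrite fE.
  apply: cvgeZl => //.
  have -> : \int[nu]_y (psi y)%:E = \int[nu]_y limn (fun n => (f n y)%:E).
    by apply: eq_integral => x _; apply/esym/cvg_lim.
  apply: (cvg_monotone_convergence measurableT (g' := fun n y => (f n y)%:E)) => //.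
  - by move=> n; exact/measurable_EFinP.
  - by move=> n x _; rewrite lee_fin.
  - by move=> x _ m n mn; rewrite lee_fin ndf.
exact: (cvg_unique _ h1 h2).
Qed.

End Density.

(** * Moments of orders 1, 2 and 4 of the standard normal law *)

Section GaussianMoments.
Context (R : realType).
Local Notation mu := (@lebesgue_measure R).
Local Notation N := (@normal_prob R 0 1).
Local Notation phi := (@normal_pdf R 0 1).

Let phi_cont : continuous phi.
Proof. by apply: continuous_normal_pdf; rewrite oner_eq0. Qed.

Let mphi : measurable_fun setT phi. Proof. exact: measurable_normal_pdf. Qed.

Lemma ge0_integral_normal (psi : R -> R) : measurable_fun setT psi ->
  (forall y, 0 <= psi y) ->
  (\int[N]_y (psi y)%:E = \int[mu]_y (phi y * psi y)%:E)%E.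
Proof.
move=> mpsi psi0; rewrite -[LHS]mul1e; apply/esym.
apply: (@ge0_integral_density _ _ _ _ _ mu N phi id 1) => //.
- by move=> x; exact: normal_pdf_ge0.
- move=> A mA; rewrite mul1e /normal_prob [RHS]integral_mkcond.
  apply: eq_integral => x _; rewrite /patch indicE.
  by case: ifP; rewrite ?mulr1 ?mulr0.
Qed.

Let c := @normal_peak R 1.
Let c0 : 0 < c. Proof. by rewrite normal_peak_gt0 ?oner_eq0. Qed.

Let phiE x : phi x = c * expR (- (x ^+ 2 / 2)).
Proof.
rewrite normal_pdfE ?oner_eq0//= /normal_fun subr0 expr1n.
by rewrite mulNr.
Qed.

Let phi_ge0 x : 0 <= phi x. Proof. exact: normal_pdf_ge0. Qed.

Let is_derive_phi (x : R) : is_derive x (1:R) (phi : R -> R) (- x * phi x).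
Proof.
have -> : phi = (fun x => c * expR (- (x ^+ 2 / 2))) :> (R -> R).
  by apply/funext => y; rewrite phiE.
apply: is_derive_eq.
by rewrite /GRing.scale/=; field.
Qed.

(** These are the boundary terms of the integrations by parts, of order at most 3. For them the
    quadratic bound [1 + y ^+ 2 / 2 <= expR y] suffices: at [y = x ^+ 2 / 2] it leaves a multiple of
    [x^-1]. *)
Let cvg_moment k : (k <= 3)%N -> x ^+ k * phi x @[x --> +oo%R] --> (0 : R).
Proof.
move=> k3; apply/cvgrPdist_lt => e e0; near=> x.
have x1 : 1 <= x by near: x; exact: nbhs_pinfty_ge.
have x0 : 0 < x by exact: lt_le_trans x1.
rewrite sub0r normrN ger0_norm ?mulr_ge0 ?exprn_ge0 ?(ltW x0)//.
have xe : c * 8 / e < x by near: x; apply: nbhs_pinfty_gt; exact: num_real.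
have h : x ^+ 4 / 8 <= expR (x ^+ 2 / 2).
  have y0 : 0 <= x ^+ 2 / 2 by rewrite divr_ge0 ?sqr_ge0.
  apply: le_trans (expR_ge1Dxn 1 y0).
  rewrite (_ : (x ^+ 2 / 2) ^+ 2 / 2`!%:R = x ^+ 4 / 8) ?lerDr//.
  by rewrite (_ : 2`! = 2%N)//; field.
have h2 : expR (- (x ^+ 2 / 2)) <= 8 / x ^+ 4.
  rewrite expRN -[8 / _]invrK lef_pV2 ?posrE ?expR_gt0 ?invr_gt0 ?divr_gt0 ?exprn_gt0//.
  by rewrite invf_div.
have h3 : x ^+ k * phi x <= x ^+ 3 * (c * (8 / x ^+ 4)).
  apply: ler_pM => //; first by rewrite exprn_ge0// ltW.
    by rewrite ler_weXn2l.
  by rewrite phiE ler_wpM2l// ltW.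
apply: le_lt_trans h3 _.
have aux (a : R) : x ^+ 3 * (a * (8 / x ^+ 4)) = a * 8 / x.
  by field; exact: lt0r_neq0.
rewrite aux.
by rewrite ltr_pdivrMr// [e * x]mulrC -ltr_pdivrMr.
Unshelve. all: end_near. Qed.

Let Phi x := \int[mu]_(t in `[0, x]) phi t.

Let int_phi (A : set R) : measurable A -> mu.-integrable A (EFin \o phi).
Proof.
move=> mA; apply: (@integrableS _ _ _ _ setT) => //.
exact: (@integrable_normal_pdf R 0 1).
Qed.

Let derive_Phi (x : R) : 0 < x -> is_derive x (1:R) (Phi : R -> R) (phi x).
Proof.
move=> x0.
have xx : x < x + 1 by rewrite ltrDl.
have ip : mu.-integrable `[0, x + 1] (EFin \o phi) by exact: int_phi.
have [d1 d2] := continuous_FTC1_closed xx ip x0 (@phi_cont x).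
have -> : phi x = 'D_1 Phi x by rewrite -derive1E; exact/esym.
exact: derivableP.
Qed.

Let Phi_at0 : Phi x @[x --> 0^'+] --> Phi 0.
Proof.
rewrite [X in _ --> X](_ : _ = 0); last first.
  by rewrite /Phi set_itv1 Rintegral_set1.
apply: cvg_at_right_filter.
apply: (@parameterized_integral_cvg_left _ 0 1) => //; exact: int_phi.
Qed.

(** The limit is first known only as a supremum, by monotonicity and boundedness; its value 1/2
    follows later from the total mass 1 of the density. *)
Let l := sup (range Phi).

Let Phi_cvg : Phi x @[x --> +oo%R] --> (l : R).
Proof.
have PhiN x : Phi x = fine (N `[0, x]) by [].
have Nfin (A : set R) : measurable A -> N A \is a fin_num by move=> mA; exact: fin_num_measure.
apply: nondecreasing_cvgr.
  move=> x y xy; rewrite !PhiN; apply: fine_le; rewrite ?Nfin//.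
  by apply: le_measure; rewrite ?inE//; apply: subset_itvl; rewrite bnd_simp.
exists 1 => _ [x _ <-]; rewrite PhiN -[leRHS]/(fine (1%:E)).
by apply: fine_le; rewrite ?Nfin// probability_le1.
Qed.

(** Evenness reduces the line to the positive half-line. A primitive is thus needed at positive
    points only, which is all that [Phi] offers: it is constantly 0 on the negative reals, where its
    interval is empty. *)
Let FTC_phi (f F : R -> R) (a : R) : (forall x, 0 <= f x) -> continuous f ->
  (forall x, f x = f (- x)) ->
  F x @[x --> +oo%R] --> a -> F 0 = 0 -> F x @[x --> 0^'+] --> F 0 ->
  (forall x : R, 0 < x -> derivable F x 1 /\ 'D_1 F x = f x) ->
  (\int[mu]_x (f x)%:E = (2 * a)%:E)%E.
Proof.
move=> f0 cf fN Fa F0 F00 dF.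
rewrite ge0_symfun_integralT// -set_itvcy.
rewrite (@ge0_continuous_FTC2y _ f F 0 a)//.
- by rewrite F0 sube0 EFinM.
- exact: continuous_subspaceT.
- by move=> x /dF [].
- by move=> x; rewrite in_itv/= andbT derive1E => /dF [].
Qed.

Let is_derive_derive1 (F : R -> R) x a : is_derive x (1:R) F a ->
  derivable F x 1 /\ 'D_1 F x = a.
Proof. by move=> d; split; [exact: ex_derive | rewrite derive_val]. Qed.

Let lE : l = 2^-1.
Proof.
have : (\int[mu]_x (phi x)%:E = (2 * l)%:E)%E.
  apply: (@FTC_phi phi Phi l) => //.
  - by move=> x; rewrite !phiE sqrrN.
  - by rewrite /Phi set_itv1 Rintegral_set1.
  - by move=> x x0; apply: is_derive_derive1; exact: derive_Phi.
rewrite integral_normal_pdf => -[] h.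
by apply: (mulfI (_ : 2 != 0)) => //; rewrite -h divff.
Qed.

Let normal_primitive : exists F : R -> R, [/\ F 0 = 0,
  F x @[x --> 0^'+] --> F 0, F x @[x --> +oo%R] --> (2^-1 : R) &
  forall x : R, 0 < x -> is_derive x (1:R) F (phi x)].
Proof.
exists Phi; split => //; last by rewrite -lE.
by rewrite /Phi set_itv1 Rintegral_set1.
Qed.

Let cvg_at0 (k : nat) : (x ^+ k * phi x) @[x --> 0^'+] --> (0 ^+ k * phi 0 : R).
Proof.
apply: cvg_at_right_filter; apply: cvgM; last exact: phi_cont.
exact: exprn_continuous.
Qed.

Let cont_moment k : continuous (fun x => phi x * x ^+ k).
Proof. by move=> x; apply: cvgM; [exact: phi_cont|exact: exprn_continuous]. Qed.

Let is_derive_moment k (x : R) :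
  is_derive x (1:R) (fun x : R => x ^+ k.+1 * phi x)
   (k.+1%:R * x ^+ k * phi x - x ^+ k.+2 * phi x).
Proof.
have d1 := is_derive_phi x.
have d2 : is_derive x (1:R) (fun x : R => x ^+ k.+1) (k.+1%:R * x ^+ k).
  have := @is_deriveX _ _ (id : R -> R) k.+1 x 1 1 (is_derive_id _ _).
  by rewrite /GRing.scale/= mulr1 exprfctE.
apply: is_derive_eq.
rewrite /GRing.scale/= [x ^+ k.+2]exprS. ring.
Qed.

Lemma normal_moment2 : (\int[N]_y (y ^+ 2)%:E = 1%:E)%E.
Proof.
have [F [F0 F00 Foo dF]] := normal_primitive.
rewrite ge0_integral_normal; [|exact: exprn_measurable|by move=> y; rewrite sqr_ge0].
(* Integration by parts as an explicit primitive: the derivative of [x * phi x] is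
   [phi x - x ^+ 2 * phi x]. *)
rewrite (@FTC_phi (fun x => phi x * x ^+ 2) (fun x => F x - x ^+ 1 * phi x) 2^-1).
- by rewrite divff.
- by move=> x; rewrite mulr_ge0 ?sqr_ge0.
- exact: cont_moment.
- by move=> x; rewrite !phiE !sqrrN.
- rewrite -[X in _ --> X]subr0; apply: cvgB => //; exact: cvg_moment.
- by rewrite F0 expr1 mul0r subr0.
- by apply: cvgB => //; exact: cvg_at0.
- move=> x x0; apply: is_derive_derive1; have dP := dF _ x0.
  have d1 := is_derive_moment 0 x.
  have d3 := is_derive_moment 2 x.
  apply: is_derive_eq.
  by rewrite /GRing.scale/=; ring.
Qed.

Lemma normal_moment4 : (\int[N]_y (y ^+ 4)%:E = 3%:E)%E.
Proof.
have [F [F0 F00 Foo dF]] := normal_primitive.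
have p4 (y : R) : 0 <= y ^+ 4 by rewrite -[4%N]/(2 * 2)%N exprM sqr_ge0.
rewrite ge0_integral_normal; [|exact: exprn_measurable|exact: p4].
(* Three times the primitive of [x ^+ 2 * phi x], corrected by [x ^+ 3 * phi x], whose derivative is
   [3 * x ^+ 2 * phi x - x ^+ 4 * phi x]. *)
rewrite (@FTC_phi (fun x => phi x * x ^+ 4)
  (fun x => 3 * (F x - x ^+ 1 * phi x) - x ^+ 3 * phi x) (3 / 2)).
- by rewrite mulrCA divff ?mulr1.
- by move=> x; rewrite mulr_ge0.
- exact: cont_moment.
- move=> x; rewrite !phiE !sqrrN.
  by rewrite -[4%N]/(2 * 2)%N !exprM !sqrrN.
- rewrite -[X in _ --> X]subr0; apply: cvgB; last exact: cvg_moment.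
  rewrite -[X in _ * X]subr0; apply: cvgMr; apply: cvgB => //; exact: cvg_moment.
- by rewrite F0 expr1 expr0n !mul0r !subr0 mulr0.
- apply: cvgB; last exact: cvg_at0.
  by apply: cvgMr; apply: cvgB => //; exact: cvg_at0.
- move=> x x0; apply: is_derive_derive1; have dP := dF _ x0.
  have d1 := is_derive_moment 0 x.
  have d3 := is_derive_moment 2 x.
  apply: is_derive_eq.
  by rewrite /GRing.scale/=; ring.
Qed.

Let normal_integrable_ge0 (f : R -> R) a : measurable_fun setT f -> (forall x, 0 <= f x) ->
  (\int[N]_x (f x)%:E = a%:E)%E -> N.-integrable setT (EFin \o f).
Proof.
move=> mf f0 fa; apply/integrableP; split; first exact/measurable_EFinP.
under eq_integral do rewrite /= ger0_norm//.
by rewrite fa ltry.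
Qed.

Lemma normal_integrable_exprn k : (k <= 4)%N ->
  N.-integrable setT (fun x => (x ^+ k)%:E).
Proof.
move=> k4.
have p4 (y : R) : 0 <= y ^+ 4 by rewrite -[4%N]/(2 * 2)%N exprM sqr_ge0.
have i4 : N.-integrable setT (EFin \o (fun x : R => x ^+ 4)).
  by apply: normal_integrable_ge0 normal_moment4 => //; exact: exprn_measurable.
have i1 : N.-integrable setT (EFin \o cst (1 : R)).
  by apply: finite_measure_integrable_cst.
apply: le_integrable (integrableD measurableT i1 i4) => //.
  by apply/measurable_EFinP; exact: exprn_measurable.
move=> x _ /=; rewrite lee_fin [leRHS]ger0_norm ?addr_ge0// normrX.
have [x1|x1] := leP `|x| 1.
  by apply: (@le_trans _ _ 1); rewrite ?exprn_ile1// lerDl.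
apply: (@le_trans _ _ (`|x| ^+ 4)); first by rewrite ler_weXn2l// ltW.
by rewrite -normrX ger0_norm// lerDr.
Qed.

(** By symmetry the absolute value integrates to twice the positive part; it is also the sum of both
    parts. So the positive and negative parts have the same finite integral and cancel. *)
Lemma normal_moment1 : (\int[N]_y y%:E = 0)%E.
Proof.
have iid : N.-integrable setT (EFin \o (fun x : R => x)).
  exact: (@normal_integrable_exprn 1).
have mmax : measurable_fun setT (fun y : R => Num.max y 0).
  exact: measurable_maxr.
have m0 (y : R) : 0 <= Num.max y 0 by rewrite le_max lexx orbT.
have hp : (\int[N]_y (`|y|)%:E = 2%:E * \int[N]_y (Num.max y 0)%:E)%E.
  rewrite !ge0_integral_normal//.
  rewrite ge0_symfun_integralT; last 3 first.
  - by move=> x; rewrite mulr_ge0.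
  - by move=> x; apply: cvgM; [exact: phi_cont|exact: norm_continuous].
  - by move=> x; rewrite /= normrN !phiE sqrrN.
  congr (_ * _)%E; rewrite integral_mkcond; apply: eq_integral => x _.
  rewrite /patch; case: ifPn; rewrite ?notin_setE ?inE/= => h.
    by rewrite ger0_norm// max_l.
  by rewrite max_r ?mulr0// ltW// ltNge; apply/negP.
rewrite -[LHS]/(\int[N]_y (EFin \o (fun x : R => x)) y)%E integralE.
have fp := integrable_pos_fin_num measurableT iid.
have fn := integrable_neg_fin_num measurableT iid.
have pE : (EFin \o (fun x : R => x))^\+%E = (fun x => (Num.max x 0)%:E).
  by apply/funext => x; rewrite funeposE/= -EFin_max.
have : (\int[N]_y (`|y|)%:E =
  \int[N]_y (EFin \o (fun x : R => x))^\+%E y + \int[N]_y (EFin \o (fun x : R => x))^\- y)%E.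
  rewrite -ge0_integralD//.
  - by apply: eq_integral => y _; rewrite -[LHS]/((abse \o (EFin \o (fun x : R => x))) y) fune_abse.
  - by apply: measurable_funepos; exact/measurable_EFinP.
  - by apply: measurable_funeneg; exact/measurable_EFinP.
rewrite hp -pE; move: fp fn => /fineK <- /fineK <-.
by rewrite -EFinM -!EFinD => -[] h; congr EFin; lra.
Qed.

End GaussianMoments.

(** * Expectation of a product of independent factors on an event *)

Section ProductRule.
Context d (T : measurableType d) (R : realType) (P : probability T R).
Context (I : finType) (Z : I -> T -> R) (mu : I -> probability (measurableTypeR R) R).
Context (B : set T) (p : R).
Hypothesis mB : measurable B.
Hypothesis mZ : forall i, measurable_fun setT (Z i).
Hypothesis p0 : 0 <= p.
Hypothesis PZ : forall A : I -> set R, (forall i, measurable (A i)) ->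
  P (B `&` [set w | forall i, A i (Z i w)]) = (p * \prod_i fine (mu i (A i)))%:E.

Let F (phi : I -> R -> R) w := \1_B w * \prod_i phi i (Z i w).

Let mF phi : (forall i, measurable_fun setT (phi i)) -> measurable_fun setT (F phi).
Proof.
move=> mphi; apply: measurable_funM; first exact: measurable_indic.
apply: measurable_prod => i _.
by apply: measurableT_comp.
Qed.

Let upd (phi : I -> R -> R) a f : I -> R -> R := fun i => if i == a then f else phi i.

Let updE phi a f w :
  F (upd phi a f) w = (\1_B w * \prod_(i | i != a) phi i (Z i w)) * f (Z a w).
Proof.
rewrite /F (bigD1 a)//= /upd eqxx [f _ * _]mulrC mulrA; congr (_ * _ * _).
by apply: eq_bigr => i /negbTE ->.
Qed.

Let upd_id phi a : upd phi a (phi a) = phi.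
Proof. by apply/funext => i; rewrite /upd; case: eqP => // ->. Qed.

Let prod_upd phi a f :
  \prod_i \int[mu i]_y upd phi a f i y =
  (\prod_(i | i != a) \int[mu i]_y phi i y) * \int[mu a]_y f y.
Proof.
rewrite (bigD1 a)//= /upd eqxx mulrC; congr (_ * _).
by apply: eq_bigr => i /negbTE ->.
Qed.

Let int_ge0 phi i : (forall y, 0 <= phi i y) -> 0 <= \int[mu i]_y phi i y.
Proof. by move=> h; apply: Rintegral_ge0. Qed.

(** Induction over the list of the indices whose factor is not an indicator. The base case is [PZ];
    a step treats one factor by [ge0_integral_density], with the product of all the others as the
    weight. *)
Let ge0_product_rule (phi : I -> R -> R) :
  (forall i, (mu i).-integrable setT (EFin \o phi i)) ->
  (forall i y, 0 <= phi i y) ->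
  (\int[P]_w (F phi w)%:E = (p * \prod_i \int[mu i]_y phi i y)%:E)%E.
Proof.
suff h (s : seq I) : (forall i, (mu i).-integrable setT (EFin \o phi i)) ->
    (forall i y, 0 <= phi i y) ->
    (forall i, i \notin s -> exists2 A, measurable A & phi i = \1_A) ->
    (\int[P]_w (F phi w)%:E = (p * \prod_i \int[mu i]_y phi i y)%:E)%E.
  by move=> iphi phi0; apply: (h (enum I)) => // i; rewrite mem_enum.
elim: s phi => [|a s IH] phi iphi phi0 ind.
  have /choice [A AE] : forall i, exists A, measurable A /\ phi i = \1_A.
    by move=> i; have [|A mA E] := ind i _; [|exists A].
  have mA i : measurable (A i) by case: (AE i).
  have {}AE i : phi i = \1_(A i) by case: (AE i).
  have mS : measurable (B `&` [set w | forall i, A i (Z i w)]).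
    apply: measurableI => //.
    have -> : [set w | forall i, A i (Z i w)] = \bigcap_(i in [set: I]) (Z i @^-1` (A i)).
      by apply/seteqP; split => [w h i _|w h i]; apply: h.
    apply: fin_bigcap_measurable => // i _.
    by rewrite -[_ @^-1` _]setTI; exact: mZ.
  have FE w : F phi w = \1_(B `&` [set w | forall i, A i (Z i w)]) w.
    rewrite /F indicI; congr (_ * _).
    rewrite indicE; case: (boolP (w \in _)); rewrite ?inE ?notin_setE/= => h.
      by rewrite big1// => i _; rewrite AE indicE mem_set//; exact: h.
    move/existsNP : h => [i h]; rewrite (bigD1 i)//= AE indicE memNset ?mul0r//.
  under eq_integral do rewrite FE.
  rewrite integral_indic// setIT.
  apply: etrans (PZ mA) _; congr (_ * _)%:E.
  apply: eq_bigr => i _; rewrite /Rintegral; congr fine.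
  by rewrite AE integral_indic ?setIT//; exact: mA.
rewrite -(upd_id phi a) prod_upd.
under eq_integral do rewrite updE.
rewrite mulrA EFinM.
have ia := iphi a.
rewrite [X in (_ * X)%E](_ : _ = \int[mu a]_y (phi a y)%:E)%E; last first.
  rewrite /Rintegral fineK//.
  by apply: integrable_fin_num.
apply: ge0_integral_density.
- apply: measurable_funM; first exact: measurable_indic.
  rewrite (_ : (fun w => _) = (fun w => \prod_i (if i != a then phi i (Z i w) else 1))).
    2: by apply/funext => w; rewrite big_mkcond.
  apply: measurable_prod => i _; case: (i != a) => //.
  apply: measurableT_comp => //.
  by have /measurable_int/measurable_EFinP := iphi i.
- by move=> w; rewrite mulr_ge0// prodr_ge0.
- exact: mZ.
- by rewrite mulr_ge0// prodr_ge0// => i _; exact: int_ge0.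
- move=> A mA; under eq_integral do rewrite -updE.
  rewrite (IH (upd phi a \1_A)).
  + rewrite prod_upd mulrA EFinM; congr (_ * _)%E.
    by rewrite /Rintegral integral_indic// setIT fineK// fin_num_measure.
  + move=> i; rewrite /upd; case: eqP => // ->.
    by apply: integrable_indic.
  + by move=> i y; rewrite /upd; case: eqP.
  + move=> i si; rewrite /upd; case: eqP => [_|/eqP ia']; first by exists A.
    by apply: ind; rewrite inE negb_or ia'.
- by have /measurable_int/measurable_EFinP := ia.
- exact: phi0.
Qed.

Let iF (phi : I -> R -> R) :
  (forall i, (mu i).-integrable setT (EFin \o phi i)) ->
  P.-integrable setT (EFin \o F phi).
Proof.
move=> iphi; apply/integrableP; split.
  apply/measurable_EFinP/mF => i.
  by have /measurable_int/measurable_EFinP := iphi i.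
have := @ge0_product_rule (fun i y => `|phi i y|) _ _.
rewrite (_ : (fun w => _) = (fun w => `|(EFin \o F phi) w|%E)).
  move=> ->; rewrite ?ltry// => i.
  have := integrable_abse (iphi i).
  by [].
apply/funext => w /=; rewrite /F !normrM normr_prod; congr (_ * _)%:E.
by rewrite indicE ger0_norm.
Qed.

(** Serves as conditional independence given [B]: the mass [p] of [B] stays as a factor instead of
    being divided out, so events of mass 0 need no separate case. *)
Lemma product_rule (phi : I -> R -> R) :
  (forall i, (mu i).-integrable setT (EFin \o phi i)) ->
  P.-integrable setT (EFin \o (fun w => \1_B w * \prod_i phi i (Z i w))) /\
  \int[P]_w (\1_B w * \prod_i phi i (Z i w)) = p * \prod_i \int[mu i]_y phi i y.
Proof.
move=> iphi; split; first exact: iF.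
(* The list now holds the indices whose factor may change sign; each step splits one of them into
   its positive and negative parts. *)
suff h (s : seq I) : (forall i, (mu i).-integrable setT (EFin \o phi i)) ->
    (forall i, i \notin s -> forall y, 0 <= phi i y) ->
    \int[P]_w (F phi w) = p * \prod_i \int[mu i]_y phi i y.
  by apply: (h (enum I)) => // i; rewrite mem_enum.
elim: s phi {iphi} => [|a s IH] phi iphi ind.
  by rewrite /Rintegral ge0_product_rule// => i y; exact: ind.
pose fp := (fun y => Num.max (phi a y) 0) : R -> R.
pose fn := (fun y => Num.max (- phi a y) 0) : R -> R.
have ifp : (mu a).-integrable setT (EFin \o fp).
  have -> : EFin \o fp = (EFin \o phi a)^\+%E.
    by apply/funext => y; rewrite funeposE /fp/= EFin_max.
  exact: (integrable_funepos measurableT (iphi a)).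
have ifn : (mu a).-integrable setT (EFin \o fn).
  have -> : EFin \o fn = (EFin \o phi a)^\-%E.
    by apply/funext => y; rewrite funenegE /fn/= EFin_max.
  exact: (integrable_funeneg measurableT (iphi a)).
have fE y : phi a y = fp y - fn y.
  rewrite /fp /fn; case: (leP 0 (phi a y)) => h.
    by rewrite max_r ?oppr_le0// subr0.
  by rewrite max_l ?oppr_ge0 ?ltW// sub0r opprK.
have iu f : (mu a).-integrable setT (EFin \o f) ->
    forall i, (mu i).-integrable setT (EFin \o upd phi a f i).
  by move=> i_f i; rewrite /upd; case: eqP => // ->.
have IHu f : (mu a).-integrable setT (EFin \o f) -> (forall y, 0 <= f y) ->
    \int[P]_w F (upd phi a f) w = p * \prod_i \int[mu i]_y upd phi a f i y.
  move=> i_f f0; apply: IH; first exact: iu.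
  move=> i si y; rewrite /upd; case: eqP => // /eqP ia.
  by apply: ind; rewrite inE negb_or ia.
have -> : F phi = (fun w => F (upd phi a fp) w - F (upd phi a fn) w).
  by apply/funext => w; rewrite -{1}(upd_id phi a) !updE fE mulrBr.
rewrite RintegralB//; [|exact/iF/iu|exact/iF/iu].
rewrite !IHu//; try by move=> y; rewrite le_max lexx orbT.
rewrite -{3}(upd_id phi a) !prod_upd -!mulrBr -RintegralB//.
by congr (_ * (_ * _)); apply: eq_Rintegral => y _; rewrite -fE.
Qed.

End ProductRule.

(** * Tails of the law of K and the eigenvalues of C *)

Section TailMean.
Context (R : realType) (PK : probability nat R).
Local Notation t := (tail PK).
Definition point_mass (k : nat) : R := fine (PK [set k]).
Definition tail_mass (i : nat) : R :=
  fine (\int[PK]_(k in [set k | (i <= k)%N]) (t k)%:E)%E.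

Let fin (A : set nat) : PK A \is a fin_num.
Proof. exact: fin_num_measure. Qed.

Lemma tailE i : (t i)%:E = PK [set k | (i <= k)%N].
Proof. by rewrite /tail fineK. Qed.

Lemma point_massE k : (point_mass k)%:E = PK [set k].
Proof. by rewrite /point_mass fineK. Qed.

Lemma point_mass_ge0 k : 0 <= point_mass k. Proof. exact: fine_ge0. Qed.

Lemma tail_ge0 i : 0 <= t i. Proof. exact: fine_ge0. Qed.

Lemma tail_le1 i : t i <= 1.
Proof. by rewrite -lee_fin tailE probability_le1. Qed.

Lemma tail_nincr i j : (i <= j)%N -> t j <= t i.
Proof.
move=> ij; rewrite -lee_fin !tailE; apply: le_measure; rewrite ?inE//.
by move=> k /=; exact: leq_trans.
Qed.

Lemma tailS k : t k = point_mass k + t k.+1.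
Proof.
apply: EFin_inj; rewrite EFinD point_massE !tailE -measureU//.
  congr (PK _); apply/seteqP; split => j /=.
    by rewrite leq_eqVlt => /orP[/eqP->|]; [left|right].
  by case=> [->|/ltnW].
by apply/seteqP; split => j //= -[-> ]; rewrite ltnn.
Qed.

Lemma sum_point_mass i n : (i <= n)%N -> \sum_(i <= k < n) point_mass k = t i - t n.
Proof.
move=> ilen; rewrite -opprB -telescope_sumr// -sumrN.
by apply: eq_bigr => k _; rewrite (tailS k); ring.
Qed.

Lemma cvg_tail0 : t n @[n --> \oo] --> (0 : R).
Proof.
have h : PK (\bigcap_n [set k | (n <= k)%N]) = 0%E.
  rewrite (_ : \bigcap_n _ = set0) ?measure0//.
  by apply/seteqP; split => k //= /(_ k.+1 Logic.I)/=; rewrite ltnn.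
have : PK [set k | (n <= k)%N] @[n --> \oo] --> PK (\bigcap_n [set k | (n <= k)%N]).
  apply: nonincreasing_cvg_mu => //.
  - by rewrite (le_lt_trans (probability_le1 _ _))// ltry.
  - by move=> m n mn; apply/subsetPset => k /=; exact: leq_trans.
by rewrite h => /fine_cvgP[_].
Qed.

Hypothesis Kinf : infinite_set [set k : nat | PK [set k] != 0%E].

(** A vanishing tail would leave only atoms below [i], hence a finite support. *)
Lemma tail_gt0 i : 0 < t i.
Proof.
rewrite lt_neqAle tail_ge0 andbT eq_sym; apply/negP => /eqP t0; apply: Kinf.
apply: (sub_finite_set _ (finite_II i)) => k /=; apply: contraNltn => ik.
rewrite eq_le measure_ge0 andbT -[leRHS]/((0:R)%:E) -t0 tailE.
by apply: le_measure; rewrite ?inE// => j /= ->.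
Qed.

Lemma cvg_tail_mass i : \sum_(i <= k < n) point_mass k * t k @[n --> \oo] --> tail_mass i.
Proof.
have E : (\int[PK]_(k in [set k | (i <= k)%N]) (t k)%:E =
          \sum_(0 <= k <oo) (if (i <= k)%N then point_mass k * t k else 0)%:E)%E.
  have -> : [set k | (i <= k)%N] = \bigcup_k (if (i <= k)%N then [set k] else set0).
    apply/seteqP; split => k /=; first by move=> ik; exists k => //; rewrite ik.
    by move=> [j _]; case: ifP => // + /= ->.
  rewrite ge0_integral_bigcup//.
  - apply: eq_eseriesr => k _.
    case: ifP => ik; last by rewrite integral_set0.
    rewrite (eq_integral (cst (t k)%:E)); last by move=> j; rewrite inE => ->.
    by rewrite integral_cst// EFinM point_massE muleC.
  - by move=> k _; rewrite lee_fin tail_ge0.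
  - apply/trivIsetP => j k _ _ jk; case: ifP => _; rewrite ?set0I//.
    case: ifP => _; rewrite ?setI0//.
    by apply/seteqP; split => l //= [->]; exact/eqP.
have fm : (\int[PK]_(k in [set k | (i <= k)%N]) (t k)%:E)%E \is a fin_num.
  rewrite ge0_fin_numE; last by apply: integral_ge0 => k _; rewrite lee_fin tail_ge0.
  apply: (@le_lt_trans _ _ (\int[PK]_(k in [set k | (i <= k)%N]) (cst 1%:E k)))%E.
    by apply: ge0_le_integral => // k _; rewrite lee_fin ?tail_ge0 ?tail_le1.
  by rewrite integral_cst// mul1e ltey_eq fin.
have := @is_cvg_nneseries R (fun k => (if (i <= k)%N then point_mass k * t k else 0)%:E) xpredT 0.
move=> /(_ _)/cvg_ex.
move=> [|l].
  by move=> k _ _; rewrite lee_fin; case: ifP => // _; rewrite mulr_ge0 ?point_mass_ge0 ?tail_ge0.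
move=> /[dup] /cvg_lim lE; rewrite -lE// -E -(fineK fm) => /fine_cvgP[_].
apply: cvg_trans; apply: near_eq_cvg; near=> n.
by rewrite /= sumEFin/= big_mkord [RHS]big_geq_mkord/= [RHS]big_mkcond.
Unshelve. all: end_near. Qed.

(** Both bounds telescope. With p_k = t_k - t_(k+1), the term p_k t_k is at least (t_k^2 -
    t_(k+1)^2) / 2, because the difference is (t_k - t_(k+1))^2 / 2; and it is at most p_k t_i for k
    >= i. *)
Lemma tail_mass_bounds i : (t i) ^+ 2 / 2 <= tail_mass i <= (t i) ^+ 2.
Proof.
apply/andP; split.
  have h : (t i ^+ 2 - t n ^+ 2) / 2 @[n --> \oo] --> (t i ^+ 2 - 0 ^+ 2) / 2.
    apply: cvgMl; apply: cvgB; first exact: cvg_cst.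
    by apply: (@cvg_comp _ _ _ t (fun x => x ^+ 2) _ _ _ cvg_tail0); exact: exprn_continuous.
  rewrite expr0n subr0 in h.
  apply: (ler_cvg_to h (@cvg_tail_mass i)); near=> n.
  have ilen : (i <= n)%N by near: n; exact: nbhs_infty_ge.
  rewrite -opprB -(telescope_sumr (fun k => t k ^+ 2))// -sumrN mulr_suml; apply: ler_sum => k _.
  have := tailS k; have := point_mass_ge0 k; have := tail_ge0 k.+1; nra.
apply: (ler_cvg_to (@cvg_tail_mass i) (cvg_cst (t i ^+ 2))); near=> n.
have ilen : (i <= n)%N by near: n; exact: nbhs_infty_ge.
apply: (@le_trans _ _ (\sum_(i <= k < n) point_mass k * t i)).
  rewrite !big_nat; apply: ler_sum => k /andP[ik _].
  by rewrite ler_wpM2l ?point_mass_ge0// tail_nincr.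
rewrite -mulr_suml sum_point_mass// expr2 ler_wpM2r ?tail_ge0// gerBl.
exact: tail_ge0.
Unshelve. all: end_near. Qed.

Lemma cond_mean_tailE i : cond_mean_tail PK t i * t i = tail_mass i.
Proof. by rewrite /cond_mean_tail -/(tail_mass i) divfK// gt_eqF// tail_gt0. Qed.

Lemma cond_mean_tail_bounds i : t i / 2 <= cond_mean_tail PK t i <= t i.
Proof.
have ti := tail_gt0 i.
have := tail_mass_bounds i; rewrite -cond_mean_tailE expr2 -[_ / 2]mulrAC.
by rewrite !ler_pM2r.
Qed.

End TailMean.

(** * Law of a random direction *)

Section StdNormal.
Context (R : realType).
Local Notation N := (@normal_prob R 0 1).

Lemma std_normal0 k : std_normal (set0 : set (k.-tuple R)) = 0%E.
Proof.
elim: k => [|k IH] /=; first by rewrite diracE in_set0.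
transitivity (\int[N]_x (cst 0 x))%E; last by rewrite integral0.
by apply: eq_integral => x _; rewrite -[RHS]IH; congr std_normal; exact/seteqP.
Qed.

(** Rectangles are the only sets at which the iterated integral gets evaluated, since [product_rule]
    asks for nothing more. *)
Lemma std_normal_rect k (A : nat -> set R) : (forall i, measurable (A i)) ->
  std_normal [set z : k.-tuple R | forall i : 'I_k, A i (tnth z i)] =
  (\prod_(i < k) fine (N (A i)))%:E.
Proof.
elim: k A => [|k IH] A mA.
  rewrite /= diracE big_ord0 mem_set//= => i.
  by case: i.
rewrite /= big_ord_recl/=.
set c := \prod_(i < k) _.
transitivity (\int[N]_x (c%:E * (\1_(A 0) x)%:E))%E.
  apply: eq_integral => x _; rewrite indicE.
  have [xA|xA] := boolP (x \in A 0).
    rewrite mule1 /c -(IH (fun i => A i.+1))//; congr std_normal.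
    apply/seteqP; split => z /= h i.
      by have := h (lift ord0 i); rewrite tnthS.
    case: (unliftP ord0 i) => [j ->|->]; first by rewrite tnthS; exact: h.
    by rewrite tnth0; rewrite inE in xA.
  rewrite mule0 -(std_normal0 k); congr std_normal.
  apply/seteqP; split => z //= h; have := h ord0; rewrite tnth0.
  by move: xA; rewrite notin_setE.
rewrite ge0_integralZl//.
- rewrite integral_indic; [|by []|exact: mA].
  rewrite setIT muleC EFinM fineK//; apply: fin_num_measure; exact: mA.
- by apply/measurable_EFinP; apply: measurable_indic; exact: mA.
- by rewrite lee_fin prodr_ge0// => i _; exact: fine_ge0.
Qed.

End StdNormal.

Section BorelIp.
Context {R : realType} {H : completeNormedModType R} (ip : {dot H for idfun}).
Hypothesis ipE : inner_norm ip.

Lemma measurable_ip x : measurable_fun [set: borel H] (ip x : borel H -> R).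
Proof.
apply: (measurability _ (RGenOpens.measurableE R)).
move=> _ [_ [a [b ->] <-]]; rewrite setTI; apply: sub_sigma_algebra.
have /continuousP := @ip_continuous _ _ ip ipE x.
apply; exact: interval_open.
Qed.

End BorelIp.

Section DirectionLaw.
Context {R : realType} {H : completeNormedModType R} (ip : {dot H for idfun}).
Context (b : nat -> H) (PK : probability nat R).
Hypothesis ipE : inner_norm ip.
Hypothesis pb : prebasis b.
Hypothesis Kinf : infinite_set [set k : nat | PK [set k] != 0%E].
Local Notation e := (gram_schmidt ip b).
Local Notation N := (@normal_prob R 0 1).

(** The diagonal of T_k^(1/2); the shift to [i.+1] is due to the 0-based coordinates. *)
Definition sqrt_tail i : R := tail PK i.+1 `^ 2^-1.

Lemma sqrt_tail_gt0 i : 0 < sqrt_tail i.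
Proof. by rewrite powR_gt0// tail_gt0. Qed.

Lemma sqr_sqrt_tail i : sqrt_tail i ^+ 2 = tail PK i.+1.
Proof.
by rewrite /sqrt_tail powR12_sqrt ?sqr_sqrtr// tail_ge0.
Qed.

Lemma directionE k (z : k.-tuple R) :
  direction ip b PK z = \sum_(i < k) ((sqrt_tail i)^-1 * tnth z i) *: e i.
Proof.
rewrite /direction -mulmxA (synth_qr ipE pb); apply: eq_bigr => i _.
by rewrite mul_diag_mx !mxE powRN.
Qed.

(* Prescribes the normalized coordinates of a direction of level [k], and the
   vanishing of all others. *)
Definition coord_box k (A : nat -> set R) : set H :=
  [set h | (forall i, (i < k)%N -> A i (sqrt_tail i * ip (e i) h)) /\
           (forall j, (k <= j)%N -> ip (e j) h = 0)].

Lemma borel_coord_box k A : (forall i, measurable (A i)) ->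
  <<s @open H >> (coord_box k A).
Proof.
move=> mA.
have mip i (B : set R) : measurable B -> (@measurable _ (borel H)) [set h : H | B (ip (e i) h)].
  move=> mB; rewrite -[X in measurable X]setTI; exact: (measurable_ip ipE).
have -> : coord_box k A =
  \bigcap_i (if (i < k)%N then [set h : H | [set x | A i (sqrt_tail i * x)] (ip (e i) h)]
             else [set h : H | [set 0] (ip (e i) h)]).
  apply/seteqP; split => h.
    by move=> [h1 h2] i _; case: ltnP => ik; [exact: h1|exact: h2].
  move=> hh; split => i ik; have := hh i Logic.I.
    by rewrite ik.
  by rewrite ltnNge ik.
apply: (@bigcapT_measurable _ (borel H)) => i.
case: ifP => _; apply: mip => //.
by rewrite -[X in measurable X]setTI; exact: mulrl_measurable.
Qed.

Lemma direction_law_box k A : (forall i, measurable (A i)) ->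
  direction_law ip b PK k (coord_box k A) = (\prod_(i < k) fine (N (A i)))%:E.
Proof.
move=> mA; rewrite -std_normal_rect// /direction_law; congr std_normal.
have ipd (z : k.-tuple R) (i : 'I_k) : sqrt_tail i * ip (e i) (direction ip b PK z) = tnth z i.
  rewrite directionE.
  (* [ip_comb] wants coefficients on all of [nat], so those of the tuple are extended by 0 through
     [insub]. *)
  have := @ip_comb _ _ ip e (gs_orthonormal ipE pb) i k
    (fun j => if insub j is Some j' then (sqrt_tail j)^-1 * tnth z j' else 0).
  rewrite ltn_ord valK /= => h.
  rewrite [X in _ * ip _ X](_ : _ = \sum_(j < k)
    (if insub (val j) is Some j' then (sqrt_tail j)^-1 * tnth z j' else 0) *: e j).
    by rewrite h mulrA divff ?mul1r// gt_eqF// sqrt_tail_gt0.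
  by apply: eq_bigr => j _; rewrite valK.
apply/seteqP; split => z /=.
  by move=> [h _] i; have := h i (ltn_ord i); rewrite ipd.
move=> h; split => [i ik|j kj].
  by have := h (Ordinal ik); rewrite -ipd.
rewrite directionE.
rewrite [X in ip _ X](_ : _ = \sum_(j < k)
    (if insub (val j) is Some j' then (sqrt_tail j)^-1 * tnth z j' else 0) *: e j).
  have := @ip_comb _ _ ip e (gs_orthonormal ipE pb) j k
    (fun j => if insub j is Some j' then (sqrt_tail j)^-1 * tnth z j' else 0).
  by rewrite ltnNge kj.
by apply: eq_bigr => i _; rewrite valK.
Qed.

End DirectionLaw.

(** * Weak measurability of vector-valued functions *)

Section Caratheodory.
Context d (X : measurableType d) (R : realType).
Import HBSimple.

(** Replacing [x] by simple functions leaves finitely many values of the parameter at a time;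
    continuity in the parameter gives the limit. No joint measurability of [g] is required. *)
Lemma measurable_caratheodory (g : X -> R -> R) (x : X -> R) :
  (forall s, measurable_fun setT (fun w => g w s)) -> (forall w, continuous (g w)) ->
  measurable_fun setT x -> measurable_fun setT (fun w => g w (x w)).
Proof.
move=> mg cg /measurable_EFinP mx.
have [q qx] := approximation_sfun measurableT mx.
apply: (measurable_fun_cvg (h := fun n w => g w (q n w))); last first.
  move=> w _; have /fine_cvgP[_ h] := qx w Logic.I.
  exact: (cvg_comp _ _ h (@cg w (x w))).
move=> n _ B mB; rewrite setTI.
have -> : (fun w => g w (q n w)) @^-1` B =
    \bigcup_(r in range (q n)) (q n @^-1` [set r] `&` (fun w => g w r) @^-1` B).
  apply/seteqP; split => w /=.
    by move=> h; exists (q n w) => //; exists w.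
  by move=> [r _ [/= <-]].
apply: fin_bigcup_measurable => // r _; apply: measurableI => //.
by rewrite -[X in measurable X]setTI; exact: mg.
Qed.

End Caratheodory.

Section CoordMeasurable.
Context {R : realType} {H : completeNormedModType R} (ip : {dot H for idfun}).
Hypothesis ipE : inner_norm ip.
Context (e : nat -> H).
Hypothesis eo : orthonormal_seq ip e.
Hypothesis ec : complete_seq ip e.
Context d (X : measurableType d).

(** Scalar products make sums and multiples measurable without recourse to the Borel sets of [H].
    The domain [D] allows for functions controlled on a single level only. *)
Definition weakly_measurable (D : set X) (h : X -> H) :=
  forall x, measurable_fun D (fun w => ip x (h w)).

Lemma weakly_measurable_ip (D : set X) (g h : X -> H) :
  weakly_measurable D g -> weakly_measurable D h ->
  measurable_fun D (fun w => ip (g w) (h w)).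
Proof.
move=> mg mh.
apply: (measurable_fun_cvg (h := fun n w => \sum_(i < n) ip (e i) (g w) * ip (e i) (h w))).
  by move=> n; apply: measurable_sum => i; exact: measurable_funM.
by move=> w _; exact: (parseval_ip ipE ec).
Qed.

Lemma weakly_measurable_norm2 (D : set X) (g : X -> H) :
  weakly_measurable D g -> measurable_fun D (fun w => `|g w| ^+ 2).
Proof.
move=> mg; rewrite (_ : (fun w => _) = (fun w => ip (g w) (g w))).
  exact: weakly_measurable_ip.
by apply/funext => w; rewrite (ip_norm ipE).
Qed.

Lemma weakly_measurable_comp (f : H -> R) (h : X -> H) : continuous f ->
  weakly_measurable setT h -> measurable_fun setT (fun w => f (h w)).
Proof.
move=> cf mh.
apply: (measurable_fun_cvg (h := fun n w => f (0 + fourier_sum ip e n (h w)))); last first.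
  move=> w _; under eq_cvg do rewrite add0r.
  exact: (cvg_comp _ _ (@ec (h w)) (@cf (h w))).
(* The base point is generalized so that the induction can absorb the last coordinate into it; that
   coordinate is then the parameter of [measurable_caratheodory]. *)
move=> n; move: (0 : H); elim: n => [|n IH] y.
  rewrite (_ : (fun w => _) = cst (f y)) //.
  by apply/funext => w; rewrite /fourier_sum big_ord0 addr0.
pose g w s := f (y + s *: e n + fourier_sum ip e n (h w)).
rewrite (_ : (fun w => _) = (fun w => g w (ip (e n) (h w)))).
  apply: measurable_caratheodory => //.
  - by move=> s; exact: IH.
  - move=> w s; apply: continuous_comp; last exact: cf.
    apply: cvgD; last exact: cvg_cst.
    apply: cvgD; first exact: cvg_cst.
    exact: scalel_continuous.
apply/funext => w; rewrite /g; congr f.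
by rewrite /fourier_sum big_ord_recr/= addrAC addrA.
Qed.

(** [get] returns a representer only if there is one; [riesz_representation] provides it for the
    continuous differential. *)
Lemma gradientP (f : H -> R) h x : differentiable (f : H -> R^o) h ->
  'd (f : H -> R^o) h x = ip (gradient ip f h) x.
Proof.
move=> df.
have [g gP] := riesz_representation ipE eo ec (@diff_continuous _ _ _ _ _ df).
have /getPex : exists g, [set g : H | forall x, 'd (f : H -> R^o) h x = ip g x] g.
  by exists g.
exact.
Qed.

(** The scalar product of the gradient with [x] is a limit of difference quotients of [f] in
    direction [x] along the steps 1 / (n + 1), each a measurable function. *)
Lemma weakly_measurable_gradient (f : H -> R) (h : X -> H) :
  (forall y, differentiable (f : H -> R^o) y) -> weakly_measurable setT h ->
  weakly_measurable setT (fun w => gradient ip f (h w)).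
Proof.
move=> df mh x.
have cf : continuous f by move=> y; exact: differentiable_continuous (df y).
apply: (measurable_fun_cvg (h := fun n w =>
   (harmonic n : R)^-1 * (f ((harmonic n : R) *: x + h w) - f (h w)))).
  move=> n; apply: measurable_funM => //; apply: measurable_funB.
    apply: weakly_measurable_comp => // y.
    rewrite (_ : (fun w => _) = (fun w => harmonic n * ip y x + ip y (h w))).
      by apply: measurable_funD.
    by apply/funext => w; rewrite ipDr ipZr.
  exact: weakly_measurable_comp.
move=> w _; rewrite ipC -gradientP// -deriveE//.
have := @diff_derivable _ _ _ (f : H -> R^o) (h w) x (df (h w)).
rewrite /derivable => /cvg_ex[l] /[dup] /cvg_lim lE.
move=> /(@cvgr_dnbhsP R (fun t => t^-1 *: (f (t *: x + h w) - f (h w)))).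
move=> /(_ (@harmonic R)) lim_l.
rewrite /derive lE//; apply: lim_l; split; last exact: cvg_harmonic.
by move=> n; rewrite gt_eqF// harmonic_gt0.
Qed.

End CoordMeasurable.

(** * Tangent inequality and Jensen's inequality *)

Section ConvexGradient.
Context {R : realType} {H : completeNormedModType R} (ip : {dot H for idfun}).
Context (f : H -> R) (g : H -> H).
Hypothesis cf : convex_function (setT : set (convex_lmodType H)) (f : H -> R^o).
Hypothesis df : forall h : H, differentiable (f : H -> R^o) h.
Hypothesis gP : forall h x, 'd (f : H -> R^o) h x = ip (g h) x.

(** By convexity each difference quotient from [x] towards [y], with step in ]0, 1], is at most
    [f y - f x]; so is their limit, the directional derivative. *)
Lemma convex_gradient_le x y : f x + ip (g x) (y - x) <= f y.
Proof.
rewrite -lerBrDl -gP -deriveE//.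
have := @diff_derivable _ _ _ (f : H -> R^o) x (y - x) (df x).
rewrite /derivable => /cvg_ex[l] /[dup] /cvg_lim lE.
move=> /(@cvgr_dnbhsP R (fun t => t^-1 *: (f (t *: (y - x) + x) - f x))).
move=> /(_ (@harmonic R)) lim_l.
have {}lim_l := lim_l (conj (fun n => lt0r_neq0 (@harmonic_gt0 R n)) cvg_harmonic).
rewrite /derive lE//.
apply: (ler_cvg_to lim_l (cvg_cst (f y - f x))); near=> n.
set t := harmonic n.
have t0 : 0 < t by exact: harmonic_gt0.
have t1 : t <= 1 by rewrite /t /harmonic/= invf_le1// ler1n.
rewrite -[leLHS]/(t^-1 * (f (t *: (y - x) + x) - f x)) mulrC ler_pdivrMr//.
have h : f (t *: y + (1 - t) *: x) <= t * f y + (1 - t) * f x.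
  by have := @cf (Itv01 (ltW t0) t1) y x; rewrite !inE => /(_ Logic.I Logic.I).
rewrite (_ : t *: (y - x) + x = t *: y + (1 - t) *: x); last first.
  by rewrite scalerBr scalerBl scale1r addrAC addrA.
by move: h; set z := f (_ + _); lra.
Unshelve. all: end_near. Qed.

Lemma convex_jensen (n : nat) (a : nat -> R) (x : nat -> H) :
  (forall i, 0 <= a i) -> 0 < \sum_(i < n) a i ->
  f ((\sum_(i < n) a i)^-1 *: \sum_(i < n) a i *: x i) <=
  (\sum_(i < n) a i)^-1 * \sum_(i < n) a i * f (x i).
Proof.
move=> a0 S0; set S := \sum_(i < n) a i; set m := S^-1 *: _.
rewrite mulrC ler_pdivlMr// mulrC.
(* Tangents are taken at the barycentre [m], where the weighted sum of the deviations [x i - m]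
   vanishes; the linear terms therefore add up to 0. *)
have -> : S * f m = \sum_(i < n) a i * (f m + ip (g m) (x i - m)).
  under [RHS]eq_bigr do rewrite mulrDr -(ipZr ip).
  rewrite big_split/= -mulr_suml -ip_sumr.
  rewrite [X in ip _ X](_ : _ = 0) ?ip0r ?addr0//.
  under eq_bigr do rewrite scalerBr.
  by rewrite sumrB -scaler_suml /m scalerA divff ?scale1r ?subrr// gt_eqF.
by apply: ler_sum => i _; rewrite ler_wpM2l// convex_gradient_le.
Qed.

End ConvexGradient.

(** * The past sigma-algebra and its independence of the next draw *)

Section Past.
Context {R : realType} {H : completeNormedModType R} {d : measure_display}
  {T : measurableType d} {P : probability T R}.
Context (K : nat -> {RV P >-> nat}) (v : nat -> nat -> {RV P >-> borel H}) (M : nat -> nat).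
Local Notation draw := (draw K v M).
Local Notation bor A := (<<s @open H >> A).

Definition cylinder n (k : nat -> nat) (A : nat -> nat -> set H) : set T :=
  \bigcap_(j in `I_n) draw j (k j) (A j).

(* A pi-system generating the sigma-algebra of the iterations before [n]. *)
Definition past_events n : set (set T) :=
  [set E | [\/ E = set0, E = setT |
    exists k A, (forall j m, bor (A j m)) /\ E = cylinder n k A]].

Definition past n := g_sigma_algebraType (past_events n).

Lemma measurable_level n k : measurable [set w | K n w = k].
Proof.
by have := @measurable_funPT _ _ _ _ (K n) measurableT [set k] I; rewrite setTI.
Qed.

Lemma measurable_draw n k A : (forall m, bor (A m)) -> measurable (draw n k A).
Proof.
move=> bA.
have -> : draw n k A = [set w | K n w = k] `&`
    \bigcap_m (if (m < M k)%N then v n m @^-1` (A m) else setT).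
  apply/seteqP; split => w /=.
    by move=> [kw h]; split => // m _; case: ifPn => // /h.
  move=> [kw h]; split => // m mM; have := h m I; by rewrite mM.
apply: measurableI; first exact: measurable_level.
apply: bigcapT_measurable => m; case: ifP => // _.
by rewrite -[X in measurable X]setTI; apply: measurable_funPT => //; exact: bA.
Qed.

Lemma measurable_cylinder n k A : (forall j m, bor (A j m)) -> measurable (cylinder n k A).
Proof.
move=> bA; apply: bigcap_measurableType => j _; exact: measurable_draw.
Qed.

Let borI (A B : set H) : bor A -> bor B -> bor (A `&` B).
Proof. exact: (@measurableI _ (borel H)). Qed.
Let borT : bor setT. Proof. exact: (@measurableT _ (borel H)). Qed.

Lemma past_events_measurable n : past_events n `<=` d.-measurable.
Proof.
by move=> _ [->|->|[k [A [bA ->]]]] //; exact: measurable_cylinder.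
Qed.

Lemma past_measurable n (E : set T) : <<s past_events n >> E -> measurable E.
Proof.
apply: smallest_sub; last exact: past_events_measurable.
exact: sigma_algebra_measurable.
Qed.

(** Cylinders with equal levels intersect draw by draw; if some level differs, the intersection is
    empty because [K j] has one value. This is why the empty set is among the generators. *)
Lemma past_events_setI n : setI_closed (past_events n).
Proof.
move=> E F [->|->|[k [A [bA ->]]]]; rewrite ?set0I ?setTI//; first by constructor 1.
move=> [->|->|[k' [A' [bA' ->]]]]; rewrite ?setI0 ?setIT; first by constructor 1.
  by constructor 3; exists k, A.
have [kk|/existsNP[j /not_implyP[jn kk]]] := pselect (forall j, (j < n)%N -> k j = k' j).
  constructor 3; exists k, (fun j m => A j m `&` A' j m); split.
    by move=> j m; exact: borI.
  apply/seteqP; split => w.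
    move=> [h h'] j jn; have [kw hA] := h j jn; have [_ hA'] := h' j jn.
    by split => // m mM; split; [exact: hA|apply: hA'; rewrite -kk].
  move=> h; split => j jn; have [kw hA] := h j jn; split => //.
  - by move=> m /hA[].
  - by rewrite -kk.
  - by move=> m; rewrite -kk// => /hA[].
constructor 1; apply/seteqP; split => w //= -[h h'].
by apply: kk; rewrite -(h j jn).1 -(h' j jn).1.
Qed.

Lemma past_draw n j k A : (j < n)%N -> (forall m, bor (A m)) ->
  (@measurable _ (past n)) (draw j k A).
Proof.
move=> jn bA.
(* A cylinder fixes the levels of all iterations, a draw only one; the draw is the countable union
   over the other levels. Outside the first [n] indices the level is set to 0, which a cylinder of
   length [n] ignores. *)
pose C (f : {ffun 'I_n -> nat}) : set T :=
  if f (Ordinal jn) == k then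
    cylinder n (fun i => oapp f 0%N (insub i)) (fun i => if i == j then A else (fun=> setT))
  else set0.
have -> : draw j k A = \bigcup_f C f.
  apply/seteqP; split => w.
    move=> [kw h]; exists [ffun i : 'I_n => K i w] => //.
    rewrite /C ffunE/= kw eqxx => i /= im; rewrite insubT/= ffunE SubK; split => // m.
    by case: (eqVneq i j) => // ->; rewrite kw => /h.
  move=> [f _]; rewrite /C; case: ifP => // /eqP fk /(_ j jn).
  by rewrite insubT /= eqxx fk.
apply: countable_bigcupT_measurable; first exact: countableP.
move=> f; rewrite /C; case: ifP => _ //.
apply: sub_sigma_algebra; constructor 3; do 2 eexists; split; last reflexivity.
by move=> i m /=; case: (i == j); [exact: bA|exact: borT].
Qed.

Lemma past_level n j k : (j < n)%N -> (@measurable _ (past n)) [set w | K j w = k].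
Proof.
move=> jn; have := @past_draw n j k (fun=> setT) jn (fun=> borT).
by congr (measurable _); apply/seteqP; split => w //= -[].
Qed.

Lemma past_widen n n' (E : set T) : (n <= n')%N ->
  <<s past_events n >> E -> <<s past_events n' >> E.
Proof.
move=> nn; apply: smallest_sub; first exact: smallest_sigma_algebra.
move=> _ [->|->|[k [A [bA ->]]]].
- exact: (@measurable0 _ (past n')).
- exact: (@measurableT _ (past n')).
- apply: (@bigcap_measurableType _ (past n')) => j /= jn.
  by apply: past_draw; [exact: leq_trans nn|exact: bA].
Qed.

Context (PK : probability nat R) (Pv : nat -> set H -> \bar R).
Hypothesis iid : iid_draws K v M PK Pv.

Let Pfin (A : set T) : measurable A -> P A \is a fin_num.
Proof. exact: fin_num_measure. Qed.

(** As functions of [E], both sides are finite measures, a restriction and a multiple of [P]; they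
    agree on the pi-system [past_events n], hence on the sigma-algebra it generates. *)
Lemma past_independent n k A E : (forall m, bor (A m)) -> <<s past_events n >> E ->
  P (E `&` draw n k A) = (P E * P (draw n k A))%E.
Proof.
move=> bA.
have mC := measurable_draw n k bA.
pose p := NngNum (fine_ge0 (measure_ge0 P (draw n k A))).
move=> hE; rewrite -[LHS]/(mrestr P mC E).
have -> : (P E * P (draw n k A) = mscale p P E)%E.
  by rewrite muleC /mscale/= fineK// Pfin.
apply: (@g_sigma_algebra_measure_unique _ _ _ (past_events n) _ (fun=> setT)) => //.
- exact: past_events_measurable.
- by move=> _; constructor 2.
- by rewrite bigcup_const//; exists 0%N.
- exact: past_events_setI.
- move=> _ [->|->|[k' [A' [bA' ->]]]].
  + by rewrite !measure0.
  + rewrite -[LHS]/(P (setT `&` draw n k A)) -[RHS]/(mscale p P setT).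
    by rewrite setTI /mscale/= probability_setT mule1 fineK// Pfin.
  rewrite -[LHS]/(P (cylinder n k' A' `&` draw n k A)).
  rewrite -[RHS]/(mscale p P (cylinder n k' A')) /mscale/= fineK ?Pfin//.
  (* Appending the draw as iteration [n] yields a cylinder of length [n.+1], to which the second
     clause of [iid_draws] applies. *)
  pose k2 j := if (j < n)%N then k' j else k.
  pose A2 j := if (j < n)%N then A' j else A.
  have bA2 j m : bor (A2 j m) by rewrite /A2; case: ifP.
  have -> : cylinder n k' A' `&` draw n k A = cylinder n.+1 k2 A2.
    apply/seteqP; split => w.
      move=> [h hn] j /=; rewrite ltnS leq_eqVlt => /orP[/eqP ->|jn].
        by rewrite /k2 /A2 ltnn.
      by rewrite /k2 /A2 jn; exact: h.
    move=> h; split.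
      by move=> j jn; have := h j (ltnW jn); rewrite /k2 /A2 jn.
    by have := h n (ltnSn n); rewrite /k2 /A2 ltnn.
  rewrite -[LHS]fineK ?Pfin//; last exact: measurable_cylinder.
  rewrite (iid.2 n.+1 k2 A2)// big_ord_recr/= {2}/k2 {2}/A2 ltnn mulrC EFinM.
  rewrite fineK ?Pfin//; congr (_ * _)%E.
  rewrite -[RHS]fineK ?Pfin//; last exact: measurable_cylinder.
  rewrite (iid.2 n k' A')//; congr EFin; apply: eq_bigr => j _.
  by rewrite /k2 /A2 ltn_ord.
- move=> _; rewrite -[ltLHS]/(P (setT `&` draw n k A)) setTI.
  by rewrite (le_lt_trans (probability_le1 _ _))// ltry.
Qed.

End Past.

(** * Adaptedness of the iterates *)

Section Iterates.
Context {R : realType} {H : completeNormedModType R} (ip : {dot H for idfun}).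
Hypothesis ipE : inner_norm ip.
Context (e : nat -> H).
Hypothesis eo : orthonormal_seq ip e.
Hypothesis ec : complete_seq ip e.
Context {d : measure_display} {T : measurableType d} {P : probability T R}.
Context (K : nat -> {RV P >-> nat}) (v : nat -> nat -> {RV P >-> borel H}) (M : nat -> nat).
Local Notation past := (past K v M).
Local Notation level j k := [set w | K j w = k].

(** Restricting to the level and to [m < M k] is essential: elsewhere [v j m] is no part of any
    draw, and nothing relates it to the past. *)
Lemma weakly_measurable_past_draw n j k m : (j < n)%N -> (m < M k)%N ->
  @weakly_measurable R H ip _ (past n) (level j k) (fun w => v j m w : H).
Proof.
move=> jn mM x _ B mB.
pose A m' := if m' == m then [set h : H | B (ip x h)] else setT.
have bA m' : <<s @open H >> (A m').
  rewrite /A; case: (m' == m); last exact: (@measurableT _ (borel H)).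
  have := measurable_ip ipE x measurableT mB; by rewrite setTI.
have -> : level j k `&` (fun w => ip x (v j m w : H)) @^-1` B = draw K v M j k A.
  apply/seteqP; split => w.
    move=> [kw h]; split => // m' _; rewrite /A.
    by case: (eqVneq m' m) => // ->.
  by move=> [kw /(_ m mM)]; rewrite /A eqxx.
exact: past_draw.
Qed.

Lemma past_glue n j (X : T -> R) : (j < n)%N ->
  (forall k, @measurable_fun _ _ (past n) R (level j k) X) ->
  @measurable_fun _ _ (past n) R setT X.
Proof.
move=> jn mX.
have -> : setT = \bigcup_k level j k by apply/seteqP; split => w // _; exists (K j w).
apply/(@measurable_fun_bigcup _ _ (past n)) => // k.
exact: past_level.
Qed.

Lemma past_measurable_fun n (X : T -> R) :
  @measurable_fun _ _ (past n) R setT X -> measurable_fun setT X.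
Proof.
move=> mX _ B mB; apply: (@past_measurable _ _ _ _ _ K v M n).
exact: mX.
Qed.

Lemma past_measurable_fun_widen n n' (X : T -> R) : (n <= n')%N ->
  @measurable_fun _ _ (past n) R setT X -> @measurable_fun _ _ (past n') R setT X.
Proof.
move=> nn mX _ B mB; apply: (past_widen nn).
exact: mX.
Qed.

Context (lam alpha : nat -> R) (f : H -> R) (h1 : H).
Hypothesis df : forall h : H, differentiable (f : H -> R^o) h.
Local Notation hn := (fgfd K v M lam alpha f h1).
Local Notation ghat := (fgfd_grad K v M lam alpha f h1).
Local Notation grad n w := (gradient ip f (hn n w)).

Lemma fgfd_gradE n w : ghat n w = (lam (K n w) / (M (K n w))%:R) *:
  \sum_(m < M (K n w)) ip (grad n w) (v n m w : H) *: (v n m w : H).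
Proof.
rewrite /fgfd_grad /fgfd_step; congr (_ *: _); apply: eq_bigr => m _.
by rewrite deriveE// (gradientP ipE eo ec).
Qed.

(** On a fixed level of [K n] the estimate is a finite sum of fixed length, made of past variables
    and of sampled vectors; [past_glue] joins the levels. *)
Let grad_step n : @weakly_measurable R H ip _ (past n.+1) setT (hn n) ->
  @weakly_measurable R H ip _ (past n.+1) setT (ghat n).
Proof.
move=> mh x.
have mg := weakly_measurable_gradient ipE eo ec df mh.
apply: (@past_glue _ n) => // k.
have mk := @past_level _ _ _ _ _ K v M n.+1 n k (ltnSn n).
apply: (@eq_measurable_fun _ _ (past n.+1) _ _ (fun w => lam k / (M k)%:R *
  \sum_(m < M k) ip (grad n w) (v n m w : H) * ip x (v n m w : H))).
  move=> w; rewrite inE /= => kw; rewrite fgfd_gradE kw ipZr ip_sumr.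
  by congr (_ * _); apply: eq_bigr => m _; rewrite ipZr.
apply: measurable_funM => //; apply: measurable_sum => m.
apply: measurable_funM; last exact: weakly_measurable_past_draw.
apply: (weakly_measurable_ip ipE ec); last exact: weakly_measurable_past_draw.
by move=> y; apply: measurable_funTS; exact: mg.
Qed.

Lemma fgfd_past n : @weakly_measurable R H ip _ (past n) setT (hn n).
Proof.
elim: n => [|n IH] x /=; first exact: measurable_cst.
have IH' : @weakly_measurable R H ip _ (past n.+1) setT (hn n).
  by move=> y; apply: past_measurable_fun_widen (IH y).
under eq_fun do rewrite ipDr ipNr ipZr.
apply: measurable_funB; first exact: IH'.
by apply: measurable_funM => //; exact: (grad_step IH').
Qed.

Lemma gradient_past n :
  @weakly_measurable R H ip _ (past n) setT (fun w => grad n w).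
Proof. exact: (weakly_measurable_gradient ipE eo ec df (@fgfd_past n)). Qed.

Lemma fgfd_grad_measurable n : weakly_measurable ip setT (ghat n).
Proof.
move=> x; apply: (@past_measurable_fun n.+1); apply: grad_step => y.
exact: (past_measurable_fun_widen (leqnSn n) (@fgfd_past n y)).
Qed.

End Iterates.

(** * Wick's formula up to order four *)

Section Wick.
Context (R : realType).
Local Notation N := (@normal_prob R 0 1).
Definition normal_moment r : R := \int[N]_y (y ^+ r).

Lemma normal_moment0 : normal_moment 0 = 1.
Proof.
rewrite /normal_moment; under eq_Rintegral do rewrite expr0.
rewrite Rintegral_cst// mul1r -[RHS]/(fine (1%:E : \bar R)).
by congr fine; exact: probability_setT.
Qed.

Lemma normal_moment1R : normal_moment 1 = 0.
Proof. by rewrite /normal_moment /Rintegral normal_moment1. Qed.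

Lemma normal_moment2R : normal_moment 2 = 1.
Proof. by rewrite /normal_moment /Rintegral normal_moment2. Qed.

Lemma normal_moment4R : normal_moment 4 = 3.
Proof. by rewrite /normal_moment /Rintegral normal_moment4. Qed.

Context (I : finType).
Implicit Types p q : I.

(** An index occurring exactly once contributes the first moment, which is 0. *)
Let prod0 (c : I -> nat) q : c q = 1%N -> \prod_l normal_moment (c l) = 0.
Proof. by move=> cq; rewrite (bigD1 q)//= cq normal_moment1R mul0r. Qed.

Let prod1 (P : pred I) (c : I -> nat) : (forall l, P l -> c l = 0%N) ->
  \prod_(l | P l) normal_moment (c l) = 1.
Proof. by move=> h; rewrite big1// => l /h ->; exact: normal_moment0. Qed.

Lemma wick2 p1 p2 :
  \prod_l normal_moment ((p1 == l) + (p2 == l)) = (p1 == p2)%:R.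
Proof.
have [<-|p12] := eqVneq p1 p2; last first.
  by rewrite (@prod0 _ p1)// eqxx eq_sym (negbTE p12).
rewrite (bigD1 p1)//= eqxx normal_moment2R mul1r prod1// => l lp.
by rewrite eq_sym (negbTE lp).
Qed.

(** The exponent of [l] counts its occurrences among the four indices, so the left side is the mixed
    moment and the right side sums over the three pairings. When all four coincide, all pairings
    count and give the fourth moment 3. *)
Lemma wick4 p1 p2 p3 p4 :
  \prod_l normal_moment ((p1 == l) + (p2 == l) + (p3 == l) + (p4 == l)) =
  (p1 == p2)%:R * (p3 == p4)%:R + (p1 == p3)%:R * (p2 == p4)%:R
  + (p1 == p4)%:R * (p2 == p3)%:R.
Proof.
have single (q : I) (c : I -> nat) (x : R) : x = 0 -> c q = 1%N ->
    \prod_l normal_moment (c l) = x by move=> ->; exact: prod0.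
have two p q (c : I -> nat) : p != q -> c p = 2 -> c q = 2 ->
    (forall l, l != p -> l != q -> c l = 0%N) -> \prod_l normal_moment (c l) = 1.
  move=> pq cp cq cl; rewrite (bigD1 p)//= (bigD1 q) 1?eq_sym//= cp cq.
  by rewrite normal_moment2R !mul1r prod1// => l /andP[]; exact: cl.
have [e12|n12] := eqVneq p1 p2; have [e34|n34] := eqVneq p3 p4.
- subst p2 p4; have [e13|n13] := eqVneq p1 p3.
    subst p3; rewrite (bigD1 p1)//= eqxx normal_moment4R prod1.
      by rewrite !mulr1; lra.
    by move=> l lp; rewrite eq_sym (negbTE lp).
  rewrite !mul0r !addr0 mulr1; apply: (two p1 p3) => //=.
  + by rewrite eqxx eq_sym (negbTE n13).
  + by rewrite eqxx (negbTE n13).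
  + by move=> l l1 l3; rewrite eq_sym (negbTE l1) eq_sym (negbTE l3).
- subst p2; have [e13|n13] := eqVneq p1 p3.
    subst p3; rewrite (negbTE n34) !mulr0 !mul0r !addr0.
    apply: (single p4) => //=.
    by rewrite eqxx (negbTE n34).
  rewrite !mul0r !mulr0 !addr0.
  apply: (single p3) => //=.
  by rewrite eqxx (negbTE n13) eq_sym (negbTE n34).
- subst p4; have [e13|n13] := eqVneq p1 p3.
    subst p3; rewrite mul0r !add0r eq_sym (negbTE n12) mulr0 addr0.
    apply: (single p2) => //=.
    by rewrite eqxx (negbTE n12).
  rewrite !mul0r !add0r; apply: (single p1) => //=.
  by rewrite eqxx eq_sym (negbTE n12) eq_sym (negbTE n13).
- rewrite mul0r add0r.
  have [e13|n13] := eqVneq p1 p3.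
    subst p3; have [e24|n24] := eqVneq p2 p4.
      subst p4; rewrite (negbTE n12) mul1r mul0r addr0.
      apply: (two p1 p2) => //=.
      + by rewrite eqxx eq_sym (negbTE n12).
      + by rewrite eqxx (negbTE n12).
      + by move=> l l1 l3; rewrite eq_sym (negbTE l1) eq_sym (negbTE l3).
    rewrite mulr0 add0r (negbTE n34) mul0r; apply: (single p4) => //=.
    by rewrite eqxx (negbTE n34) (negbTE n24).
  rewrite mul0r add0r; have [e14|n14] := eqVneq p1 p4.
    subst p4; have [e23|n23] := eqVneq p2 p3.
      subst p3; rewrite mul1r; apply: (two p1 p2) => //=.
      + by rewrite eqxx eq_sym (negbTE n12).
      + by rewrite eqxx (negbTE n12).
      + by move=> l l1 l3; rewrite eq_sym (negbTE l1) eq_sym (negbTE l3).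
    rewrite mulr0; apply: (single p3) => //=.
    by rewrite eqxx (negbTE n13) (negbTE n23).
  rewrite mul0r; apply: (single p1) => //=.
  by rewrite eqxx eq_sym (negbTE n12) eq_sym (negbTE n13) eq_sym (negbTE n14).
Qed.

End Wick.

(** * Moments of one draw on a level *)

Section LinearIntegral.
Context d (T : measurableType d) (R : realType) (mu : {measure set T -> \bar R}).

Lemma integrable_Rsum (J : Type) (s : seq J) (F : J -> T -> R) :
  (forall j, mu.-integrable setT (EFin \o F j)) ->
  mu.-integrable setT (EFin \o (fun w => \sum_(j <- s) F j w)) /\
  \int[mu]_w (\sum_(j <- s) F j w) = \sum_(j <- s) \int[mu]_w F j w.
Proof.
move=> iF.
have iS s' : mu.-integrable setT (EFin \o (fun w => \sum_(j <- s') F j w)).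
  rewrite (_ : _ \o _ = (fun w => \sum_(j <- s') (F j w)%:E)).
    by apply: (integrable_sum measurableT) => j _; exact: iF.
  by apply/funext => w /=; rewrite sumEFin.
split => //; elim: s => [|j s IH].
  rewrite big_nil; under eq_Rintegral do rewrite big_nil.
  by rewrite /Rintegral integral0.
rewrite big_cons -IH -RintegralD//.
by apply: eq_Rintegral => w _; rewrite big_cons.
Qed.

End LinearIntegral.

Section DrawMoments.
Context {R : realType} {H : completeNormedModType R} (ip : {dot H for idfun}).
Context (b : nat -> H) (PK : probability nat R).
Hypothesis ipE : inner_norm ip.
Hypothesis pb : prebasis b.
Hypothesis Kinf : infinite_set [set k : nat | PK [set k] != 0%E].
Context {d : measure_display} {T : measurableType d} {P : probability T R}.
Context (K : nat -> {RV P >-> nat}) (v : nat -> nat -> {RV P >-> borel H}) (M : nat -> nat).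
Hypothesis iid : iid_draws K v M PK (direction_law ip b PK).
Local Notation past := (past K v M).
Local Notation e := (gram_schmidt ip b).
Local Notation N := (@normal_prob R 0 1).

(* On the level [K n = k] these are the standard normal coordinates [z_i], [i < k], of the
   [m]-th direction [v = B_k R_k^-1 T_k^(-1/2) z]. *)
Definition noise n m i (w : T) : R := sqrt_tail PK i * ip (e i) (v n m w : H).

(* The almost sure part of the level [K n = k] on which all the directions lie in the
   span of [e_0, ..., e_(k-1)]. *)
Definition level_support n k : set T :=
  draw K v M n k (fun=> coord_box ip b PK k (fun=> setT)).

Lemma measurable_level_support n k : measurable (level_support n k).
Proof. by apply: measurable_draw => m; exact: borel_coord_box. Qed.

Lemma measurable_noise n m i : measurable_fun setT (noise n m i).
Proof.
apply: measurable_funM => //.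
by apply: (measurableT_comp (measurable_ip ipE (e i))).
Qed.

Lemma draw_box_prob n k (A : nat -> nat -> set R) :
  (forall m i, measurable (A m i)) ->
  P (draw K v M n k (fun m => coord_box ip b PK k (A m))) =
  (point_mass PK k * \prod_(m < M k) \prod_(i < k) fine (N (A m i)))%:E.
Proof.
move=> mA.
have bA m : <<s @open H >> (coord_box ip b PK k (A m)) by exact: borel_coord_box.
rewrite -[LHS]fineK; last by apply: fin_num_measure; exact: measurable_draw.
rewrite iid.1//; congr (_ * _)%:E; apply: eq_bigr => m _.
by rewrite direction_law_box.
Qed.

Lemma level_prob n k : P [set w | K n w = k] = (point_mass PK k)%:E.
Proof.
have bT : <<s @open H >> (setT : set H) by exact: (@measurableT _ (borel H)).
have -> : [set w | K n w = k] = draw K v M n k (fun=> setT).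
  by apply/seteqP; split => w //= -[].
rewrite -[LHS]fineK; last by apply: fin_num_measure; exact: measurable_draw.
rewrite iid.1// big1 ?mulr1// => m _.
rewrite /direction_law preimage_setT.
have := @std_normal_rect R k (fun=> setT) (fun=> measurableT).
rewrite (_ : [set z | _] = setT) => [->|]; last exact/seteqP.
by rewrite /= big1// => i _; rewrite probability_setT.
Qed.

Lemma level_support_prob n k : P (level_support n k) = (point_mass PK k)%:E.
Proof.
rewrite /level_support (@draw_box_prob n k (fun _ _ => setT))//.
by rewrite big1 ?mulr1// => m _; rewrite big1// => i _; rewrite probability_setT.
Qed.

Lemma level_support_sub n k : level_support n k `<=` [set w | K n w = k].
Proof. by move=> w []. Qed.

Lemma level_support_ae n k : P ([set w | K n w = k] `\` level_support n k) = 0%E.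
Proof.
have ml := measurable_level K n k.
have ms := measurable_level_support n k.
rewrite measureD//; last by rewrite (le_lt_trans (probability_le1 _ _))// ltry.
rewrite setIidr; last exact: level_support_sub.
by rewrite [X in (X - _)%E]level_prob [X in (_ - X)%E]level_support_prob subee.
Qed.

Lemma level_support_coord n k w m j : level_support n k w -> (m < M k)%N -> (k <= j)%N ->
  ip (e j) (v n m w : H) = 0.
Proof. by move=> [_ h] mM kj; have [_] := h m mM; exact. Qed.

(** The past variable [X] joins the normal coordinates as one more independent factor, with its own
    distribution; that is the summand ['I_1] of the index type. Exponents up to 4 are those whose
    integrability is established. *)
Lemma draw_moment n k (X : T -> R) (r : 'I_(M k) * 'I_k -> nat) :
  @measurable_fun _ _ (past n) R setT X ->
  P.-integrable setT (EFin \o X) -> (forall l, (r l <= 4)%N) ->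
  let Y w := \1_(level_support n k) w *
    (X w * \prod_(l : 'I_(M k) * 'I_k) noise n l.1 l.2 w ^+ r l) in
  P.-integrable setT (EFin \o Y) /\
  \int[P]_w Y w = point_mass PK k * (\int[P]_w X w * \prod_l normal_moment R (r l)).
Proof.
move=> pX iX r4 Y.
have mX : measurable_fun setT X by exact: past_measurable_fun pX.
have mX2 : @measurable_fun _ _ T (measurableTypeR R) setT X by exact: mX.
pose X' := @mfun_Sub d _ T (measurableTypeR R) X (mem_set mX2).
pose law : probability (measurableTypeR R) R := @distribution _ _ T (measurableTypeR R) R P X'.
have X'E : (X' : T -> measurableTypeR R) = X by exact: (mfun_valP (mem_set mX2)).
pose J : finType := ('I_1 + 'I_(M k) * 'I_k)%type.
pose Z (j : J) : T -> R := match j with inl _ => X | inr l => noise n l.1 l.2 end.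
pose mu (j : J) : probability (measurableTypeR R) R :=
  match j with inl _ => law | inr _ => N end.
pose phi (j : J) : R -> R := match j with inl _ => id | inr l => fun y => y ^+ r l end.
have iX' : P.-integrable setT (EFin \o (X' : T -> measurableTypeR R)) by rewrite X'E.
have [] := @product_rule _ T R P J Z mu (level_support n k) (point_mass PK k)
  (measurable_level_support n k) _ (point_mass_ge0 _ _) _ phi _.
- by case=> [a|l]; [exact: mX|exact: measurable_noise].
- move=> A mA.
  (* [coord_box] takes sets indexed by [nat]; out of range the default [setT] imposes nothing. *)
  pose A' m i := if insub m is Some m' then
     if insub i is Some i' then A (inr (m', i')) else setT else setT.
  have mA' m i : measurable (A' m i).
    rewrite /A'; case: insub => [m'|]; last exact: measurableT.
    by case: insub => [i'|]; [exact: mA|exact: measurableT].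
  have -> : level_support n k `&` [set w | forall j, A j (Z j w)] =
     (X @^-1` (A (inl ord0))) `&` draw K v M n k (fun m => coord_box ip b PK k (A' m)).
    apply/seteqP; split => w.
      move=> [[kw hs] h]; split; first exact: (h (inl ord0)).
      split => // m mM; have [_ hz] := hs m mM; split => // i ik.
      rewrite /A' (insubT (fun m => m < M k)%N mM) (insubT (fun i => i < k)%N ik).
      exact: (h (inr (Sub m mM, Sub i ik))).
    move=> [hX [kw h]]; split.
      by split => // m mM; have [_ hz] := h m mM; split.
    case=> [a|[m i]]; first by rewrite (ord1 a).
    have [h1 _] := h m (ltn_ord m); have := h1 i (ltn_ord i).
    by rewrite /A' !valK.
  rewrite (past_independent iid); last 2 first.
  + by move=> m; exact: borel_coord_box.
  + have := pX measurableT _ (mA (inl ord0)); rewrite setTI; exact.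
  rewrite draw_box_prob// big_sumType/= big_ord1/=.
  rewrite muleC -(@fineK _ (P (X @^-1` _))); last first.
    apply: fin_num_measure; rewrite -[X in measurable X]setTI; apply: mX => //; exact: mA.
  rewrite -EFinM -mulrA; congr (_ * _)%:E; rewrite mulrC; congr (_ * _).
  rewrite pair_big/=; apply: eq_bigr => -[m i] _.
  by rewrite /A' !valK.
- case=> [a|l] /=; last exact: normal_integrable_exprn.
  apply: (@integrable_pushforward _ _ T (measurableTypeR R) R X' mX2 P setT (EFin \o id)) => //.
  by apply/measurable_EFinP; exact: measurable_id.
have YE : (fun w => \1_(level_support n k) w * \prod_i phi i (Z i w)) = Y.
  by apply/funext => w; rewrite big_sumType/= big_ord1.
rewrite YE => iY ->; split => //.
rewrite big_sumType/= big_ord1/=; congr (_ * (_ * _)).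
rewrite /Rintegral integral_distribution//.
Qed.

End DrawMoments.

(** * Sums of the pairings over samples and coordinates *)

Section FiniteSums.
Context (R : realType).

Lemma sum_delta (I : finType) (i : I) (F : I -> R) : \sum_j F j * (j == i)%:R = F i.
Proof.
by rewrite (bigD1 i)//= eqxx mulr1 big1 ?addr0// => j /negbTE ->; rewrite mulr0.
Qed.

Lemma prod_delta (I : finType) (i : I) (x : I -> R) : \prod_j x j ^+ (i == j) = x i.
Proof.
rewrite (bigD1 i)//= eqxx expr1 big1 ?mulr1// => j.
by rewrite eq_sym => /negbTE ->; rewrite expr0.
Qed.

Let natr_andb (a b : bool) : (a && b)%:R = a%:R * b%:R :> R.
Proof. by case: a; case: b; rewrite ?mulr1 ?mulr0. Qed.

Lemma wick2_sum M k (i : 'I_k) (F : 'I_k -> R) :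
  \sum_(l : 'I_M * 'I_k) F l.2 * (l == (l.1, i))%:R = M%:R * F i.
Proof.
rewrite -(pair_bigA _ (fun m j => F j * ((m, j) == (m, i))%:R))/=.
rewrite (eq_bigr (fun=> F i)); first by rewrite sumr_const card_ord mulr_natl.
move=> m _; rewrite -[RHS](sum_delta i F); apply: eq_bigr => j _.
by rewrite xpair_eqE eqxx.
Qed.

(** Indices are pairs (sample, coordinate). The pairing inside each factor leaves the samples free
    and gives [M ^ 2] terms at coordinate [i]; the two pairings across the factors force equal
    samples, hence a single [M]: one sums all coordinates, the other keeps [i]. *)
Lemma wick4_sum M k (i : 'I_k) (F : 'I_k -> 'I_k -> R) :
  \sum_(q : ('I_M * 'I_k) * ('I_M * 'I_k)) F q.1.2 q.2.2 *
    ((q.1 == (q.1.1, i))%:R * (q.2 == (q.2.1, i))%:R +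
     (q.1 == q.2)%:R * ((q.1.1, i) == (q.2.1, i))%:R +
     (q.1 == (q.2.1, i))%:R * ((q.1.1, i) == q.2)%:R) =
  M%:R ^+ 2 * F i i + M%:R * (\sum_j F j j + F i i).
Proof.
rewrite -(pair_bigA _ (fun l l' => F l.2 l'.2 *
    ((l == (l.1, i))%:R * (l' == (l'.1, i))%:R +
     (l == l')%:R * ((l.1, i) == (l'.1, i))%:R +
     (l == (l'.1, i))%:R * ((l.1, i) == l')%:R)))/=.
transitivity (\sum_(l : 'I_M * 'I_k) ((M%:R * F l.2 i) * (l == (l.1, i))%:R +
    F l.2 l.2 + F l.2 i * (l == (l.1, i))%:R)).
  apply: eq_bigr => -[m j] _ /=.
  under eq_bigr do rewrite !mulrDr.
  rewrite !big_split/=; congr (_ + _ + _).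
  - rewrite -(@wick2_sum M k i (fun j' => F j j')) mulr_suml.
    by apply: eq_bigr => l _; rewrite mulrA mulrAC -mulrA mulrC -!mulrA.
  - rewrite -[RHS](@sum_delta _ (m, j) (fun l => F j l.2)).
    apply: eq_bigr => -[m' j'] _ /=; rewrite !xpair_eqE eqxx andbT natr_andb.
    rewrite natr_andb (eq_sym m' m) (eq_sym j' j).
    by case: (m == m'); rewrite ?mul1r ?mulr1 ?mul0r ?mulr0.
  - rewrite -[RHS](@sum_delta _ (m, i) (fun l => F j l.2 * ((m, j) == (m, i))%:R)).
    apply: eq_bigr => -[m' j'] _ /=; rewrite !xpair_eqE eqxx/= !natr_andb.
    rewrite (eq_sym m m') (eq_sym i j').
    by case: (m' == m); rewrite ?mul0r ?mulr0 ?mul1r ?mulrA.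
rewrite !big_split/= (wick2_sum M i (fun j => M%:R * F j i)) (wick2_sum M i (fun j => F j i)).
rewrite -(pair_bigA _ (fun m j => F j j))/= sumr_const card_ord -mulr_natl.
by ring.
Qed.

End FiniteSums.

(** * Weighted variance summed over coordinates and levels *)

Section VarianceBound.
Context (R : realType) (PK : probability nat R).
Hypothesis Kinf : infinite_set [set k : nat | PK [set k] != 0%E].
Context (c : R).
Hypothesis c0 : 0 < c.
Local Notation t := (tail PK).
Local Notation gam i := (cond_mean_tail PK t i.+1).

(** Convertible with the [M] of the theorem, so the hypothesis on the draws applies as it stands. *)
Definition batch (k : nat) : nat := `|Num.ceil (k%:R / c : R)|%N.

Lemma batch_ge k : k%:R <= c * (batch k)%:R.
Proof.
rewrite mulrC -ler_pdivrMr//.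
have q0 : 0 <= k%:R / c by rewrite divr_ge0// ltW.
have z0 : 0 <= Num.ceil (k%:R / c : R) by rewrite -(ceil0 R) le_ceil.
by rewrite /batch natr_absz ger0_norm// ceil_ge.
Qed.

Lemma batch_gt0 k : (0 < k)%N -> (0 < batch k)%N.
Proof.
move=> k0; rewrite lt0n; apply/negP => /eqP b0.
by have := batch_ge k; rewrite b0 mulr0 lern0 => /eqP k0'; rewrite k0' in k0.
Qed.

Lemma cond_mean_gt0 i : 0 < gam i.
Proof.
have /andP[h _] := cond_mean_tail_bounds Kinf i.+1.
by apply: lt_le_trans h; rewrite divr_gt0// tail_gt0.
Qed.

Lemma cond_mean_le1 i : gam i <= 1.
Proof.
have /andP[_ h] := cond_mean_tail_bounds Kinf i.+1.
by apply: le_trans h _; exact: tail_le1.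
Qed.

(* The conditional second moment, given [K = k], of the [i]-th coordinate ([i < k]) of the
   gradient estimate, [G j] being the second moment of the [j]-th coordinate of the gradient. *)
Definition level_variance (G : nat -> R) k i : R :=
  t k ^+ 2 / t i.+1 * (G i / t i.+1 +
   (batch k)%:R^-1 * (\sum_(j < k) G j / t j.+1 + G i / t i.+1)).

Lemma level_variance_ge0 G k i : (forall j, 0 <= G j) -> 0 <= level_variance G k i.
Proof.
move=> G0; have q0 j : 0 <= G j / t j.+1 by rewrite divr_ge0// tail_ge0.
rewrite mulr_ge0 ?divr_ge0 ?sqr_ge0 ?tail_ge0// addr_ge0// mulr_ge0 ?invr_ge0//.
by rewrite addr_ge0// sumr_ge0.
Qed.

(** The first sum is the squared mean, kept exact for cancellation over the levels. In the
    fluctuation each weight is at most 2, as t_k <= t_(i+1) <= 2 gamma_i, and the batch size then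
    absorbs the number of coordinates. *)
Lemma level_variance_sum (G : nat -> R) k : (forall j, 0 <= G j) ->
  \sum_(i < k) (gam i)^-1 * level_variance G k i <=
  \sum_(i < k) t k ^+ 2 * (G i / (gam i * t i.+1 ^+ 2)) + 4 * c * \sum_(j < k) G j / t j.+1.
Proof.
move=> G0; case: k => [|k]; first by rewrite !big_ord0; lra.
set q := fun j => G j / t j.+1.
have q0 j : 0 <= q j by rewrite divr_ge0// tail_ge0.
set S := \sum_(j < k.+1) q j.
have S0 : 0 <= S by apply: sumr_ge0.
have m0 : 0 < (batch k.+1)%:R :> R by rewrite ltr0n batch_gt0.
have hb := batch_ge k.+1.
set m := (batch k.+1)%:R in m0 hb.
have w2 i : (i < k.+1)%N -> (gam i)^-1 * (t k.+1 ^+ 2 / t i.+1) <= 2.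
  move=> ik; have gi := cond_mean_gt0 i; have ti := tail_gt0 Kinf i.+1.
  have tk : t k.+1 <= t i.+1 by apply: tail_nincr.
  have /andP[h _] := cond_mean_tail_bounds Kinf i.+1.
  rewrite mulrC ler_pdivrMr// ler_pdivrMr//.
  have := tail_ge0 PK k.+1; nra.
have E i : (gam i)^-1 * level_variance G k.+1 i =
    t k.+1 ^+ 2 * (G i / (gam i * t i.+1 ^+ 2)) +
    (gam i)^-1 * (t k.+1 ^+ 2 / t i.+1) * (m^-1 * (S + q i)).
  rewrite /level_variance -/S -/m /q.
  have := cond_mean_gt0 i; have := tail_gt0 Kinf i.+1.
  by move=> /lt0r_neq0 h1 /lt0r_neq0 h2; field; rewrite h1 h2 lt0r_neq0.
under eq_bigr do rewrite E.
rewrite big_split/= lerD2l.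
apply: (@le_trans _ _ (\sum_(i < k.+1) 2 * (m^-1 * (S + q i)))).
  apply: ler_sum => i _; apply: ler_wpM2r; last exact: w2.
  by rewrite mulr_ge0 ?invr_ge0 ?(ltW m0)// addr_ge0.
rewrite -mulr_sumr -mulr_sumr big_split/= sumr_const card_ord -/S -[S *+ k.+1]mulr_natl.
have -> : 2 * (m^-1 * (k.+1%:R * S + S)) = 2 * ((k.+1%:R + 1) / m) * S.
  by field; rewrite lt0r_neq0.
apply: ler_wpM2r => //.
have : (k.+1%:R + 1) / m <= 2 * c.
  rewrite ler_pdivrMr//; apply: le_trans (_ : 2 * k.+1%:R <= _).
    by rewrite mulr2n mulrDl !mul1r lerD2l ler1n.
  by rewrite -mulrA ler_wpM2l.
lra.
Qed.

(** After exchanging sums, coordinate [i] meets the levels k > i only. For the squared mean, one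
    factor t_k is bounded by t_(i+1) and the remaining sum of p_k t_k by gamma_i t_(i+1), which
    leaves [G i]. For the fluctuation, the sum of p_k is at most t_(i+1), which cancels the
    denominator. *)
Lemma total_variance_bound (G : nat -> R) n : (forall j, 0 <= G j) ->
  \sum_(k < n) point_mass PK k * \sum_(i < k) (gam i)^-1 * level_variance G k i <=
  (1 + 4 * c) * \sum_(j < n) G j.
Proof.
move=> G0.
have swap (F : nat -> nat -> R) : \sum_(k < n) \sum_(i < k) F k i =
    \sum_(i < n) \sum_(i.+1 <= k < n) F k i.
  transitivity (\sum_(k < n) \sum_(i < n | (i < k)%N) F k i).
    apply: eq_bigr => k _.
    by rewrite (big_ord_widen n (fun i => F k i))// ltnW.
  under eq_bigr do rewrite big_mkcond.
  rewrite exchange_big/=; apply: eq_bigr => i _.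
  by rewrite big_geq_mkord/= [RHS]big_mkcond.
have psum i : \sum_(i.+1 <= k < n) point_mass PK k <= t i.+1.
  have [h|h] := leqP i.+1 n; last by rewrite big_geq ?tail_ge0// ltnW.
  by rewrite sum_point_mass// gerBl tail_ge0.
apply: (@le_trans _ _ (\sum_(k < n) \sum_(i < k)
   (point_mass PK k * (t k ^+ 2 * (G i / (gam i * t i.+1 ^+ 2))) +
    4 * c * (point_mass PK k * (G i / t i.+1))))).
  apply: ler_sum => k _.
  apply: le_trans (ler_wpM2l (point_mass_ge0 PK k) (level_variance_sum k G0)) _.
  rewrite mulrDr mulr_sumr big_split/= lerD2l.
  by rewrite -2!mulr_sumr mulrCA.
rewrite (swap (fun k i => point_mass PK k * (t k ^+ 2 * (G i / (gam i * t i.+1 ^+ 2))) +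
    4 * c * (point_mass PK k * (G i / t i.+1)))).
rewrite mulr_sumr; apply: ler_sum => i _.
rewrite big_split/= [leRHS]mulrDl mul1r; apply: lerD.
  have gi := cond_mean_gt0 i; have ti := tail_gt0 Kinf i.+1.
  have h : \sum_(i.+1 <= k < n) point_mass PK k * t k <= gam i * t i.+1.
    rewrite cond_mean_tailE//.
    have cvm := @cvg_tail_mass _ PK i.+1.
    rewrite -(cvg_lim _ cvm)//; apply: nondecreasing_cvgn_le; last by apply/cvg_ex; eexists; exact: cvm.
    apply/nondecreasing_seqP => m; have [h|h] := leqP i.+1 m.
      by rewrite [leRHS]big_nat_recr//= lerDl mulr_ge0 ?point_mass_ge0 ?tail_ge0.
    by rewrite (big_geq h) big_geq// ltnW.
  apply: (@le_trans _ _ ((\sum_(i.+1 <= k < n) point_mass PK k * t k) * (G i / (gam i * t i.+1)))).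
    rewrite mulr_suml !big_nat; apply: ler_sum => k /andP[ik _].
    rewrite -mulrA ler_wpM2l ?point_mass_ge0//.
    have -> : G i / (gam i * t i.+1) = t i.+1 * (G i / (gam i * t i.+1 ^+ 2)).
      by field; rewrite !lt0r_neq0.
    rewrite [leRHS]mulrA ler_wpM2r//; first by rewrite divr_ge0// mulr_ge0 ?sqr_ge0 ?(ltW gi).
    by rewrite expr2 ler_wpM2l ?tail_ge0// tail_nincr.
  apply: le_trans (ler_wpM2r _ h) _; first by rewrite divr_ge0// mulr_ge0 ?ltW.
  by rewrite mulrC divfK// lt0r_neq0// mulr_gt0.
rewrite -mulr_sumr -mulr_suml; apply: ler_wpM2l; first by rewrite mulr_ge0// ltW.
rewrite mulrCA ler_piMr//.
by rewrite ler_pdivrMr ?tail_gt0// mul1r.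
Qed.

End VarianceBound.

(** * Convergence theorems for real integrals *)

Section RealIntegrals.
Context d (T : measurableType d) (R : realType) (mu : {measure set T -> \bar R}).
Local Notation L1 f := (mu.-integrable setT (EFin \o f)).

Lemma integrable_dom (f g : T -> R) : measurable_fun setT f ->
  (forall x, `|f x| <= g x) -> L1 g -> L1 f.
Proof.
move=> mf fg; apply: le_integrable => //; first exact/measurable_EFinP.
move=> x _ /=; rewrite lee_fin; apply: le_trans (fg x) _; exact: ler_norm.
Qed.

Lemma L1_measurable (f : T -> R) : L1 f -> measurable_fun setT f.
Proof. by move=> /integrableP[/measurable_EFinP]. Qed.

Lemma integrable_Rscale a (f : T -> R) : L1 f -> L1 (fun w => a * f w).
Proof. by move=> h; have := integrableZl measurableT a h. Qed.

Lemma integrable_RD (f g : T -> R) : L1 f -> L1 g -> L1 (fun w => f w + g w).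
Proof. by move=> hf hg; have := integrableD measurableT hf hg. Qed.

Lemma integrable_Rnorm (f : T -> R) : L1 f -> L1 (fun w => `|f w|).
Proof. by move=> h; have := integrable_norm h. Qed.

Lemma integrable_mul_sq (f g : T -> R) : measurable_fun setT f -> measurable_fun setT g ->
  L1 (fun w => f w ^+ 2) -> L1 (fun w => g w ^+ 2) -> L1 (fun w => f w * g w).
Proof.
move=> mf mg hf hg; apply: (@integrable_dom _ (fun w => f w ^+ 2 + g w ^+ 2)).
- exact: measurable_funM.
- move=> w; rewrite ler_norml; apply/andP.
  have := sqr_ge0 (f w - g w); have := sqr_ge0 (f w + g w).
  have := sqr_ge0 (f w); have := sqr_ge0 (g w).
  by split; nra.
- exact: integrable_RD.
Qed.

Lemma dominated_Rconvergence (F : nat -> T -> R) (f g : T -> R) :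
  (forall n, measurable_fun setT (F n)) -> measurable_fun setT f ->
  {ae mu, forall w, F n w @[n --> \oo] --> f w} -> L1 g ->
  (forall n w, `|F n w| <= g w) ->
  \int[mu]_w F n w @[n --> \oo] --> (\int[mu]_w f w : R).
Proof.
move=> mF mf Ff ig Fg.
have [||||ff _ +] := @dominated_convergence _ _ R mu setT measurableT
  (fun n => EFin \o F n) (EFin \o f) (EFin \o g) _ _ _ ig.
- by move=> n; exact/measurable_EFinP.
- exact/measurable_EFinP.
- by apply: filterS Ff => w h _; apply: cvg_EFin => //; exact: nearW.
- by apply: aeW => w n _ /=; rewrite lee_fin.
rewrite -(fineK (integrable_fin_num measurableT ff)) => /fine_cvgP[_]; exact.
Qed.

(** Integrability of the limit is a conclusion: a uniform bound on the approximations delivers it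
    together with the estimate. *)
Lemma monotone_Rbound (F : nat -> T -> R) (f : T -> R) C :
  (forall n, L1 (F n)) -> (forall n w, 0 <= F n w) ->
  (forall w, nondecreasing_seq (F^~ w)) ->
  measurable_fun setT f -> (forall w, 0 <= f w) ->
  {ae mu, forall w, F n w @[n --> \oo] --> f w} ->
  (forall n, \int[mu]_w F n w <= C) -> L1 f /\ \int[mu]_w f w <= C.
Proof.
move=> iF F0 ndF mf f0 Ff FC.
have mF n : measurable_fun setT (EFin \o F n) by case/integrableP: (iF n).
have ndE w : {homo (fun n => (F n w)%:E) : n m / (n <= m)%N >-> (n <= m)%E}.
  by move=> n m nm; rewrite lee_fin ndF.
have cF w : cvgn (fun n => (F n w)%:E).
  by apply: ereal_nondecreasing_is_cvgn; exact: ndE.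
have fE : (\int[mu]_w (f w)%:E <= C%:E)%E.
  rewrite (@ge0_ae_eq_integral _ _ _ _ _ _ (fun w => limn (fun n => (F n w)%:E)))//.
  - rewrite (monotone_convergence mu measurableT (g' := fun n => EFin \o F n))//.
    + apply: lime_le.
        apply/cvg_ex; eexists; apply: cvg_monotone_convergence => //.
          by move=> n w _; rewrite lee_fin.
        by move=> w _; exact: ndE.
      apply: nearW => n; rewrite -(fineK (integrable_fin_num measurableT (iF n))) lee_fin.
      exact: FC.
    + by move=> n w _; rewrite lee_fin.
    + by move=> w _; exact: ndE.
  - exact/measurable_EFinP.
  - apply: (@emeasurable_fun_cvg _ _ _ _ (fun n => EFin \o F n)) => // w _; exact: cF.
  - by move=> w _; rewrite lee_fin.
  - by move=> w _; apply: lime_ge => //; apply: nearW => n; rewrite lee_fin.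
  - apply: filterS Ff => w h _; apply/esym/cvg_lim => //.
    by apply: cvg_EFin => //; exact: nearW.
have fL : L1 f.
  apply/integrableP; split; first exact/measurable_EFinP.
  under eq_integral do rewrite /= ger0_norm//.
  by rewrite (le_lt_trans fE)// ltry.
split => //; rewrite -lee_fin fineK//; exact: integrable_fin_num.
Qed.

End RealIntegrals.

(** * Splitting an expectation over the levels *)

Section LevelPartition.
Context {R : realType} {H : completeNormedModType R} (ip : {dot H for idfun}).
Context (b : nat -> H) (PK : probability nat R).
Hypothesis ipE : inner_norm ip.
Hypothesis pb : prebasis b.
Hypothesis Kinf : infinite_set [set k : nat | PK [set k] != 0%E].
Context {d : measure_display} {T : measurableType d} {P : probability T R}.
Context (K : nat -> {RV P >-> nat}) (v : nat -> nat -> {RV P >-> borel H}) (M : nat -> nat).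
Hypothesis iid : iid_draws K v M PK (direction_law ip b PK).
Context (n : nat).
Local Notation B k := (level_support ip b PK K v M n k).
Local Notation L1 f := (P.-integrable setT (EFin \o f)).

Lemma level_support_all : {ae P, forall w, B (K n w) w}.
Proof.
have h : P.-negligible (\bigcup_k ([set w | K n w = k] `\` B k)).
  apply: negligible_bigcup => k.
  exists ([set w | K n w = k] `\` B k); split => //.
    apply: measurableD; first exact: measurable_level.
    exact: measurable_level_support.
  exact: (level_support_ae ipE pb Kinf iid n k).
apply: negligibleS h => w /= hw; by exists (K n w).
Qed.

Lemma level_indicE w k : \1_(B k) w = (K n w == k)%:R * \1_(B (K n w)) w :> R.
Proof.
case: eqVneq => [->|nk]; first by rewrite mul1r.
rewrite mul0r indicE memNset// => /level_support_sub /= h.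
by rewrite h eqxx in nk.
Qed.

(** Only the term [j = K n w] can be nonzero, so a partial sum over the levels is a truncation of
    [X], dominated by its absolute value. *)
Lemma level_sumE (X : T -> R) w k : \sum_(j < k) \1_(B j) w * X w =
  (K n w < k)%N%:R * \1_(B (K n w)) w * X w.
Proof.
under eq_bigr do rewrite level_indicE.
rewrite -!mulr_suml; congr (_ * _ * _).
have [h|h] := ltnP (K n w) k.
  rewrite (bigD1 (Ordinal h))//= eqxx big1 ?addr0// => j.
  by rewrite -val_eqE eq_sym => /negbTE /= ->.
by rewrite big1// => j _; rewrite gtn_eqF// (leq_trans (ltn_ord j)).
Qed.

Lemma level_sum_cvg (X : T -> R) :
  {ae P, forall w, \sum_(j < k) \1_(B j) w * X w @[k --> \oo] --> X w}.
Proof.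
apply: filterS level_support_all => w Bw.
apply: cvg_near_cst; near=> k.
rewrite level_sumE indicE mem_set// mulr1.
have -> : (K n w < k)%N by near: k; exact: nbhs_infty_gt.
by rewrite mul1r.
Unshelve. all: end_near. Qed.

Let mB k : measurable (B k).
Proof. exact: (@measurable_level_support _ _ _ _ _ ipE _ _ _ K v M n k). Qed.

Lemma level_Rbound (X : T -> R) C : measurable_fun setT X -> (forall w, 0 <= X w) ->
  (forall k, L1 (fun w => \1_(B k) w * X w)) ->
  (forall k, \sum_(j < k) \int[P]_w (\1_(B j) w * X w) <= C) ->
  L1 X /\ \int[P]_w X w <= C.
Proof.
move=> mX X0 iX XC.
have iS k := integrable_Rsum (index_enum 'I_k) (fun j : 'I_k => iX j).
apply: (@monotone_Rbound _ _ _ _ (fun k w => \sum_(j < k) \1_(B j) w * X w)) => //.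
- by move=> k; have [] := iS k.
- by move=> k w; apply: sumr_ge0 => j _; rewrite mulr_ge0.
- move=> w; apply/nondecreasing_seqP => k.
  by rewrite big_ord_recr/= lerDl mulr_ge0.
- exact: level_sum_cvg.
- by move=> k; rewrite (iS k).2; exact: XC.
Qed.

Lemma level_Rcvg (X : T -> R) : L1 X ->
  \sum_(j < k) \int[P]_w (\1_(B j) w * X w) @[k --> \oo] --> (\int[P]_w X w : R).
Proof.
move=> iX; have mX := L1_measurable iX.
have iX' k : L1 (fun w => \1_(B k) w * X w).
  apply: (@integrable_dom _ _ _ _ _ (fun w => `|X w|)).
  - by apply: measurable_funM => //; exact: measurable_indic.
  - by move=> w; rewrite normrM ler_piMl// indicE; case: (_ \in _); rewrite ?normr1 ?normr0.
  - exact: (integrable_Rnorm iX).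
have iS k := integrable_Rsum (index_enum 'I_k) (fun j : 'I_k => iX' j).
under eq_fun do rewrite -(iS _).2.
apply: (@dominated_Rconvergence _ _ _ _ _ _ (fun w => `|X w|)) => //.
- by move=> k; apply: L1_measurable (iS k).1.
- exact: level_sum_cvg.
- exact: (integrable_Rnorm iX).
- move=> k w; rewrite level_sumE normrM ler_piMl// indicE.
  by case: (_ < _)%N; case: (_ \in _); rewrite ?mul1r ?mul0r ?normr1 ?normr0.
Qed.

End LevelPartition.

(** * First two moments of the estimate on one level *)

Section LevelMoments.
Context {R : realType} {H : completeNormedModType R} (ip : {dot H for idfun}).
Context (b : nat -> H) (PK : probability nat R).
Hypothesis ipE : inner_norm ip.
Hypothesis pb : prebasis b.
Hypothesis Kinf : infinite_set [set k : nat | PK [set k] != 0%E].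
Context {d : measure_display} {T : measurableType d} {P : probability T R}.
Context (K : nat -> {RV P >-> nat}) (v : nat -> nat -> {RV P >-> borel H}) (M : nat -> nat).
Hypothesis iid : iid_draws K v M PK (direction_law ip b PK).
Context (lam : nat -> R) (n : nat) (g : T -> H).
Local Notation e := (gram_schmidt ip b).
Local Notation B k := (level_support ip b PK K v M n k).
Local Notation L1 f := (P.-integrable setT (EFin \o f)).
Local Notation t := (tail PK).
Local Notation s := (sqrt_tail PK).
Local Notation past := (past K v M).
Local Notation Z l w := (noise ip b PK v n l.1 l.2 w).
Hypothesis gpast : @weakly_measurable R H ip _ (past n) setT g.
Hypothesis g2 : L1 (fun w => `|g w| ^+ 2).

(** The gradient is replaced by an arbitrary vector [g] known from the past; what follows uses only
    its weak measurability and square integrability. *)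
Definition estimate (w : T) : H := (lam (K n w) / (M (K n w))%:R) *:
  \sum_(m < M (K n w)) ip (g w) (v n m w : H) *: (v n m w : H).

Definition second_moment j : R := \int[P]_w (ip (e j) (g w) ^+ 2).

Let eo : orthonormal_seq ip e := gs_orthonormal ipE pb.
Let ec : complete_seq ip e := gs_complete ipE pb.

Let mcoord j : measurable_fun setT (fun w => ip (e j) (g w)).
Proof. exact: (past_measurable_fun (@gpast (e j))). Qed.

Lemma coord_sq_le j x : ip (e j) x ^+ 2 <= `|x| ^+ 2.
Proof.
apply: le_trans (bessel ipE eo j.+1 x).
by rewrite big_ord_recr/= lerDr sumr_ge0// => i _; exact: sqr_ge0.
Qed.

Lemma coord_L2 j : L1 (fun w => ip (e j) (g w) ^+ 2).
Proof.
apply: integrable_dom g2; first exact: measurable_funX.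
by move=> w; rewrite ger0_norm ?sqr_ge0//; exact: coord_sq_le.
Qed.

(** On the support [v n m] has no coordinates beyond [k], so the Parseval series is a finite sum. *)
Lemma level_support_ip k w m x : B k w -> (m < M k)%N ->
  ip x (v n m w : H) = \sum_(j < k) ip (e j) x * ip (e j) (v n m w : H).
Proof.
move=> Bw mM; rewrite -(cvg_lim (@Rhausdorff R) (@parseval_ip _ _ _ ipE e ec x (v n m w))).
apply/cvg_lim => //; apply: cvg_near_cst; near=> L.
have kL : (k <= L)%N by near: L; exact: nbhs_infty_ge.
rewrite -(big_mkord xpredT (fun j => ip (e j) x * ip (e j) (v n m w : H))).
rewrite (@big_cat_nat _ _ _ k)//= big_mkord [X in _ + X = _]big_nat [X in _ + X]big1 ?addr0// => j /andP[kj _].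
by rewrite (level_support_coord Bw mM kj) mulr0.
Unshelve. all: end_near. Qed.

Lemma estimate_high k i w : (k <= i)%N -> B k w -> ip (e i) (estimate w) = 0.
Proof.
move=> ki Bw; have kw := level_support_sub Bw; rewrite /= in kw.
rewrite /estimate ipZr ip_sumr big1 ?mulr0// => m _; rewrite ipZr.
have mM : (m < M k)%N by rewrite -kw.
by rewrite (level_support_coord Bw mM ki) mulr0.
Qed.

(** A coordinate of [v n m] is its normalized version divided by [s], whence the denominators. The
    sum runs over sample and coordinate at once, the index type of the Wick lemmas. *)
Lemma estimate_low k (i : 'I_k) w : B k w -> ip (e i) (estimate w) =
  \sum_(l : 'I_(M k) * 'I_k) (lam k / (M k)%:R / (s l.2 * s i)) *
     (ip (e l.2) (g w) * (Z l w * Z (l.1, i) w)).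
Proof.
move=> Bw; have kw := level_support_sub Bw; rewrite /= in kw.
rewrite /estimate ipZr kw ip_sumr mulr_sumr.
rewrite -(pair_bigA _ (fun (m : 'I_(M k)) (j : 'I_k) => (lam k / (M k)%:R / (s j * s i)) *
     (ip (e j) (g w) * (noise ip b PK v n m j w * noise ip b PK v n m i w))))/=.
apply: eq_bigr => m _; rewrite ipZr (level_support_ip _ Bw)// mulr_suml mulr_sumr.
apply: eq_bigr => j _; rewrite /noise.
have := sqrt_tail_gt0 Kinf i; have := sqrt_tail_gt0 Kinf j.
by move=> /lt0r_neq0 hj /lt0r_neq0 hi; set q := lam k / _; field; rewrite hi hj.
Qed.

(** Only the terms with coordinate [i] survive Wick's formula; there are [M k] of them, cancelling
    the averaging factor, and the two factors [s i] combine to [t i.+1]. *)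
Lemma level_mean k (i : 'I_k) (u : T -> R) : (0 < M k)%N ->
  @measurable_fun _ _ (past n) R setT u -> L1 (fun w => u w ^+ 2) ->
  L1 (fun w => \1_(B k) w * (ip (e i) (estimate w) * u w)) /\
  \int[P]_w (\1_(B k) w * (ip (e i) (estimate w) * u w)) =
  point_mass PK k * lam k / t i.+1 * \int[P]_w (ip (e i) (g w) * u w).
Proof.
move=> M0 pu u2; have mu := past_measurable_fun pu.
pose c (l : 'I_(M k) * 'I_k) := lam k / (M k)%:R / (s l.2 * s i).
pose X (l : 'I_(M k) * 'I_k) w := ip (e l.2) (g w) * u w.
pose r (l q : 'I_(M k) * 'I_k) := ((l == q) + ((l.1, i) == q))%N.
have iX l : L1 (X l) by apply: integrable_mul_sq => //; exact: coord_L2.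
have pX l : @measurable_fun _ _ (past n) R setT (X l).
  by apply: measurable_funM => //; exact: gpast.
have r4 l q : (r l q <= 4)%N by rewrite /r; case: (_ == _); case: (_ == _).
have E : (fun w => \1_(B k) w * (ip (e i) (estimate w) * u w)) =
    fun w => \sum_l c l * (\1_(B k) w * (X l w * \prod_(q : 'I_(M k) * 'I_k) Z q w ^+ r l q)).
  apply/funext => w; have [Bw|Bw] := pselect (B k w); last first.
    by rewrite indicE memNset//= mul0r big1// => l _; rewrite mul0r mulr0.
  rewrite indicE mem_set// mul1r estimate_low// mulr_suml; apply: eq_bigr => l _.
  under eq_bigr do rewrite exprD.
  rewrite big_split/= !prod_delta /X mul1r/=.
  by rewrite -/(c l); ring.
have D l := draw_moment ipE pb Kinf iid (pX l) (iX l) (r4 l).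
rewrite E; have [|h1 h2] := @integrable_Rsum _ _ R P _ (index_enum _)
  (fun l w => c l * (\1_(B k) w * (X l w * \prod_(q : 'I_(M k) * 'I_k) Z q w ^+ r l q))).
  by move=> l; apply: integrable_Rscale; exact: (D l).1.
split => //; rewrite h2.
under eq_bigr => l _ do rewrite RintegralZl ?(D l).2 ?(D l).1// wick2.
pose F j := lam k / (M k)%:R / (s j * s i) * point_mass PK k *
   \int[P]_w (ip (e j) (g w) * u w).
transitivity (\sum_(l : 'I_(M k) * 'I_k) F l.2 * (l == (l.1, i))%:R).
  by apply: eq_bigr => l _; rewrite /F /c !mulrA.
rewrite (@wick2_sum _ _ _ i (fun j : 'I_k => F j)) /F -expr2 sqr_sqrt_tail.
have M1 : (M k)%:R != 0 :> R by rewrite pnatr_eq0 -lt0n.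
have ti := lt0r_neq0 (tail_gt0 Kinf i.+1).
by field; rewrite M1 ti.
Qed.

(** Squaring doubles the index. Of the pairings summed in [wick4_sum], the one of order [M ^ 2]
    gives the squared mean; the others lose a factor [M] and are the sampling fluctuation. *)
Lemma level_square k (i : 'I_k) : (0 < M k)%N ->
  L1 (fun w => \1_(B k) w * ip (e i) (estimate w) ^+ 2) /\
  \int[P]_w (\1_(B k) w * ip (e i) (estimate w) ^+ 2) =
  point_mass PK k * (lam k ^+ 2 / t i.+1 * (second_moment i / t i.+1 +
   (M k)%:R^-1 * (\sum_(j < k) second_moment j / t j.+1 + second_moment i / t i.+1))).
Proof.
move=> M0.
pose A := ('I_(M k) * 'I_k)%type.
pose c (l : A) := lam k / (M k)%:R / (s l.2 * s i).
pose X (p : A * A) w := ip (e p.1.2) (g w) * ip (e p.2.2) (g w).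
pose r (p : A * A) (q : A) :=
  ((p.1 == q) + ((p.1.1, i) == q) + (p.2 == q) + ((p.2.1, i) == q))%N.
have iX p : L1 (X p) by apply: integrable_mul_sq => //; exact: coord_L2.
have pX p : @measurable_fun _ _ (past n) R setT (X p).
  by apply: measurable_funM; exact: gpast.
have r4 p q : (r p q <= 4)%N.
  by rewrite /r; do 4 case: (_ == _).
have E : (fun w => \1_(B k) w * ip (e i) (estimate w) ^+ 2) =
    fun w => \sum_p c p.1 * c p.2 * (\1_(B k) w * (X p w * \prod_(q : 'I_(M k) * 'I_k) Z q w ^+ r p q)).
  apply/funext => w; have [Bw|Bw] := pselect (B k w); last first.
    by rewrite indicE memNset//= mul0r big1// => l _; rewrite mul0r mulr0.
  rewrite indicE mem_set// mul1r estimate_low// expr2 mulr_suml.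
  rewrite -(pair_bigA _ (fun l l' => c l * c l' *
    (1%:R * (X (l, l') w * \prod_(q : 'I_(M k) * 'I_k) Z q w ^+ r (l, l') q))))/=.
  apply: eq_bigr => l _; rewrite mulr_sumr; apply: eq_bigr => l' _.
  under eq_bigr do rewrite !exprD.
  rewrite !big_split/= !prod_delta /X mul1r/=.
  by rewrite -/(c l) -/(c l'); ring.
have D p := draw_moment ipE pb Kinf iid (pX p) (iX p) (r4 p).
rewrite E; have [|h1 h2] := @integrable_Rsum _ _ R P _ (index_enum _)
  (fun p w => c p.1 * c p.2 * (\1_(B k) w * (X p w * \prod_(q : 'I_(M k) * 'I_k) Z q w ^+ r p q))).
  by move=> p; apply: integrable_Rscale; exact: (D p).1.
split => //; rewrite h2.
under eq_bigr => p _ do rewrite RintegralZl ?(D p).2 ?(D p).1// wick4.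
pose F (j j' : 'I_k) := (lam k / (M k)%:R) ^+ 2 / (s j * s i) / (s j' * s i) * point_mass PK k *
   \int[P]_w (ip (e j) (g w) * ip (e j') (g w)).
transitivity (\sum_(q : A * A) F q.1.2 q.2.2 *
    ((q.1 == (q.1.1, i))%:R * (q.2 == (q.2.1, i))%:R +
     (q.1 == q.2)%:R * ((q.1.1, i) == (q.2.1, i))%:R +
     (q.1 == (q.2.1, i))%:R * ((q.1.1, i) == q.2)%:R)).
  by apply: eq_bigr => p _; rewrite /F /c; ring.
rewrite wick4_sum.
have M1 : (M k)%:R != 0 :> R by rewrite pnatr_eq0 -lt0n.
have F2 j : F j j = (lam k / (M k)%:R) ^+ 2 * point_mass PK k / t i.+1 *
    (second_moment j / t j.+1).
  rewrite /F -!sqr_sqrt_tail /second_moment.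
  under eq_Rintegral do rewrite -expr2.
  have := sqrt_tail_gt0 Kinf i; have := sqrt_tail_gt0 Kinf j.
  by move=> /lt0r_neq0 hi /lt0r_neq0 hj; field; rewrite hi hj M1.
under eq_bigr do rewrite F2.
rewrite F2 -mulr_sumr.
have ti := lt0r_neq0 (tail_gt0 Kinf i.+1).
by field; rewrite M1 ti.
Qed.

End LevelMoments.

(** * Moments of the estimate over all levels *)

Section EstimateMoments.
Context {R : realType} {H : completeNormedModType R} (ip : {dot H for idfun}).
Context (b : nat -> H) (PK : probability nat R).
Hypothesis ipE : inner_norm ip.
Hypothesis pb : prebasis b.
Hypothesis Kinf : infinite_set [set k : nat | PK [set k] != 0%E].
Context {d : measure_display} {T : measurableType d} {P : probability T R}.
Context (K : nat -> {RV P >-> nat}) (v : nat -> nat -> {RV P >-> borel H}).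
Context (c : R).
Hypothesis c0 : 0 < c.
Local Notation M := (batch c).
Hypothesis iid : iid_draws K v M PK (direction_law ip b PK).
Context (n : nat) (g : T -> H).
Local Notation e := (gram_schmidt ip b).
Local Notation B k := (level_support ip b PK K v M n k).
Local Notation L1 f := (P.-integrable setT (EFin \o f)).
Local Notation t := (tail PK).
Local Notation gam i := (cond_mean_tail PK t i.+1).
Local Notation past := (past K v M).
Hypothesis gpast : @weakly_measurable R H ip _ (past n) setT g.
Hypothesis g2 : L1 (fun w => `|g w| ^+ 2).
Local Notation est := (estimate ip K v M t n g).
Hypothesis mest : weakly_measurable ip setT est.
Local Notation G := (second_moment ip b (P := P) g).

Let eo : orthonormal_seq ip e := gs_orthonormal ipE pb.
Let ec : complete_seq ip e := gs_complete ipE pb.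

Lemma sum_second_moment k : \sum_(j < k) G j <= \int[P]_w (`|g w| ^+ 2).
Proof.
have [iS <-] := integrable_Rsum (index_enum 'I_k)
  (fun j : 'I_k => coord_L2 ipE pb gpast g2 j).
apply: le_Rintegral => // w _; exact: bessel.
Qed.

Lemma level_squareE k i : L1 (fun w => \1_(B k) w * ip (e i) (est w) ^+ 2) /\
  \int[P]_w (\1_(B k) w * ip (e i) (est w) ^+ 2) =
  if (i < k)%N then point_mass PK k * level_variance PK c G k i else 0.
Proof.
have [ik|ki] := ltnP i k.
  have k0 : (0 < k)%N by exact: leq_ltn_trans ik.
  exact: (level_square ipE pb Kinf iid t gpast g2 (Ordinal ik) (batch_gt0 c0 k0)).
have -> : (fun w => \1_(B k) w * ip (e i) (est w) ^+ 2) = cst 0.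
  apply/funext => w; have [Bw|Bw] := pselect (B k w); last first.
    by rewrite indicE memNset// mul0r.
  by rewrite (estimate_high _ _ ki Bw) expr0n mulr0.
by split; [exact: integrable0|rewrite Rintegral_cst// mul0r].
Qed.

Lemma sum_lt_le (F : nat -> R) L k : (forall i, 0 <= F i) ->
  \sum_(i < L) (if (i < k)%N then F i else 0) <= \sum_(i < k) F i.
Proof.
move=> F0; have [Lk|kL] := leqP L k.
  rewrite (big_ord_widen k (fun i => if (i < k)%N then F i else 0) Lk) big_mkcond.
  by apply: ler_sum => i _; rewrite ltn_ord; case: ifP.
by rewrite (big_ord_widen L F (ltnW kL)) -big_mkcond.
Qed.

(** The bound does not depend on the truncation [L]. At level [j] the coordinates from [j] on
    vanish, so [L] may be traded for [j] before the levels are summed. *)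
Lemma estimate_variance L :
  L1 (fun w => \sum_(i < L) (gam i)^-1 * ip (e i) (est w) ^+ 2) /\
  \int[P]_w (\sum_(i < L) (gam i)^-1 * ip (e i) (est w) ^+ 2) <=
  (1 + 4 * c) * \int[P]_w (`|g w| ^+ 2).
Proof.
have gi i : 0 <= (gam i)^-1 by rewrite invr_ge0 ltW// cond_mean_gt0.
have E k : (fun w => \1_(B k) w * \sum_(i < L) (gam i)^-1 * ip (e i) (est w) ^+ 2) =
    (fun w => \sum_(i < L) (gam i)^-1 * (\1_(B k) w * ip (e i) (est w) ^+ 2)).
  by apply/funext => w; rewrite mulr_sumr; apply: eq_bigr => i _; rewrite mulrCA.
have I k := integrable_Rsum (index_enum 'I_L)
  (fun i : 'I_L => integrable_Rscale (gam i)^-1 (level_squareE k i).1).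
have G0 j : 0 <= G j by apply: Rintegral_ge0 => w _; exact: sqr_ge0.
apply: (level_Rbound ipE pb Kinf iid (n := n)).
- apply: measurable_sum => i; apply: measurable_funM => //.
  by apply: measurable_funX; exact: mest.
- by move=> w; apply: sumr_ge0 => i _; rewrite mulr_ge0// sqr_ge0.
- by move=> k; rewrite E; exact: (I k).1.
move=> k; apply: (@le_trans _ _ ((1 + 4 * c) * \sum_(j < k) G j)); last first.
  by rewrite ler_wpM2l ?sum_second_moment// addr_ge0// mulr_ge0// ltW.
apply: le_trans (total_variance_bound Kinf c0 k G0).
apply: ler_sum => j _; rewrite E (I j).2.
under eq_bigr => i _ do rewrite RintegralZl ?(level_squareE j i).1// (level_squareE j i).2.
rewrite mulr_sumr.
apply: le_trans (sum_lt_le L j (F := fun i => point_mass PK j * ((gam i)^-1 * level_variance PK c G j i)) _).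
  apply: ler_sum => i _; case: ifP => _; last by rewrite mulr0.
  by rewrite mulrCA.
by move=> i; rewrite mulr_ge0 ?point_mass_ge0// mulr_ge0// level_variance_ge0.
Qed.

(** The weights are at least 1, so the weighted bound controls the plain norm of the estimate as
    well. *)
Let inv_gam_ge1 i : 1 <= (gam i)^-1.
Proof. by rewrite invf_ge1 ?cond_mean_gt0// cond_mean_le1. Qed.

Let est_sq_le L w : \sum_(i < L) ip (e i) (est w) ^+ 2 <=
  \sum_(i < L) (gam i)^-1 * ip (e i) (est w) ^+ 2.
Proof. by apply: ler_sum => i _; rewrite ler_peMl ?sqr_ge0. Qed.

Lemma estimate_coord_L2 i : L1 (fun w => ip (e i) (est w) ^+ 2).
Proof.
apply: integrable_dom (estimate_variance i.+1).1.
  by apply: measurable_funX; exact: mest.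
move=> w; rewrite ger0_norm ?sqr_ge0//; apply: le_trans (est_sq_le _ _).
by rewrite big_ord_recr/= lerDr sumr_ge0// => j _; exact: sqr_ge0.
Qed.

Lemma estimate_L2 : L1 (fun w => `|est w| ^+ 2).
Proof.
have I L := integrable_Rsum (index_enum 'I_L) (fun i : 'I_L => estimate_coord_L2 i).
apply: (@monotone_Rbound _ _ _ _ (fun L w => \sum_(i < L) ip (e i) (est w) ^+ 2)
  _ ((1 + 4 * c) * \int[P]_w (`|g w| ^+ 2)) _ _ _ _ _ _ _).1.
- by move=> L; exact: (I L).1.
- by move=> L w; apply: sumr_ge0 => i _; exact: sqr_ge0.
- move=> w; apply/nondecreasing_seqP => L.
  by rewrite big_ord_recr/= lerDl sqr_ge0.
- exact: (weakly_measurable_norm2 ipE ec).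
- by move=> w; exact: sqr_ge0.
- by apply: aeW => w; exact: (parseval ipE ec).
- move=> L; apply: le_trans (estimate_variance L).2.
  apply: le_Rintegral => //; first exact: (I L).1.
  exact: (estimate_variance L).1.
Qed.

(** Square integrability of the coordinate comes first, so that the sum over the levels converges to
    the full integral. The levels contribute p_k t_k / t_(i+1) for k > i, and these add up to
    gamma_i. *)
Lemma estimate_mean i (u : T -> R) :
  @measurable_fun _ _ (past n) R setT u -> L1 (fun w => u w ^+ 2) ->
  L1 (fun w => ip (e i) (est w) * u w) /\
  \int[P]_w (ip (e i) (est w) * u w) = gam i * \int[P]_w (ip (e i) (g w) * u w).
Proof.
move=> pu u2.
have iX : L1 (fun w => ip (e i) (est w) * u w).
  apply: integrable_mul_sq u2; [exact: mest|exact: (past_measurable_fun pu)|].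
  exact: estimate_coord_L2.
split => //; set I := \int[P]_w (ip (e i) (g w) * u w).
have D k : \int[P]_w (\1_(B k) w * (ip (e i) (est w) * u w)) =
    if (i < k)%N then point_mass PK k * t k / t i.+1 * I else 0.
  have [ik|ki] := ltnP i k.
    have k0 : (0 < k)%N by exact: leq_ltn_trans ik.
    exact: (level_mean ipE pb Kinf iid t gpast g2 (Ordinal ik) (batch_gt0 c0 k0) pu u2).2.
  rewrite (_ : (fun w => _) = cst 0) ?Rintegral_cst ?mul0r//.
  apply/funext => w; have [Bw|Bw] := pselect (B k w); last first.
    by rewrite indicE memNset// mul0r.
  by rewrite (estimate_high _ _ ki Bw) mul0r mulr0.
have h1 := @level_Rcvg _ _ ip b PK ipE pb Kinf _ _ _ K v M iid n _ iX.
have h2 : \sum_(i.+1 <= k < L) point_mass PK k * t k / t i.+1 * I @[L --> \oo] -->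
    tail_mass PK i.+1 / t i.+1 * I.
  under eq_fun do rewrite -!mulr_suml.
  by apply: cvgMl; apply: cvgMl; exact: cvg_tail_mass.
rewrite -(cvg_lim (@Rhausdorff R) h1).
rewrite -cond_mean_tailE// mulfK ?lt0r_neq0 ?tail_gt0// in h2.
rewrite -(cvg_lim (@Rhausdorff R) h2).
congr (limn _); apply/funext => L.
rewrite big_geq_mkord/= big_mkcond/= [RHS]big_mkcond/=.
by apply: eq_bigr => k _; rewrite D.
Qed.

End EstimateMoments.

(** * The norm of C on its range *)

Section SourceNorm.
Context {R : realType} {H : completeNormedModType R} (ip : {dot H for idfun}).
Hypothesis ipE : inner_norm ip.
Context (e : nat -> H).
Hypothesis eo : orthonormal_seq ip e.
Hypothesis ec : complete_seq ip e.
Context (gam : nat -> R).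
Hypothesis gam0 : forall i, 0 < gam i.
Local Notation rangeC := [set diag_pow ip e gam 2^-1 h | h in diag_pow_dom ip e gam 2^-1].

Lemma diag_pow_coord s y i : diag_pow_dom ip e gam s y ->
  ip (e i) (diag_pow ip e gam s y) = gam i `^ s * ip (e i) y.
Proof.
move=> ys; apply: (fourier_coord_limit ipE eo (a := fun i => gam i `^ s * ip (e i) y)).
by move: ys; rewrite /diag_pow_dom /diag_pow /diag_pow_series/= seriesEord.
Qed.

(** If the two points are C^(1/2) y and C^(1/2) y', the series of C^(-1/2) at their difference is
    the Fourier series of y' - y, so its limit exists; Bessel's inequality for y' - y does the
    rest. *)
Lemma source_norm_ge h h' L : rangeC h -> rangeC h' ->
  \sum_(i < L) (gam i)^-1 * ip (e i) (h' - h) ^+ 2 <=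
  `|diag_pow ip e gam (- 2^-1) (h' - h)| ^+ 2.
Proof.
move=> [y yD <-] [y' yD' <-].
set z := _ - _; have {yD yD'}E i : ip (e i) z = Num.sqrt (gam i) * ip (e i) (y' - y).
  rewrite /z !(ipDr, ipNr) (diag_pow_coord i yD) (diag_pow_coord i yD').
  by rewrite powR12_sqrt ?ltW// mulrDr mulrN.
have -> : diag_pow ip e gam (- 2^-1) z = y' - y.
  move: z E => z E; apply/cvg_lim => //; rewrite /diag_pow_series seriesEord.
  rewrite [X in X @ _ --> _](_ : _ = fun n => fourier_sum ip e n (y' - y)); first exact: ec.
  apply/funext => n; apply: eq_bigr => i _; rewrite E mulrA powRN powR12_sqrt ?ltW// mulVf ?mul1r//.
  by rewrite gt_eqF// sqrtr_gt0.
apply: le_trans (bessel ipE eo L (y' - y)); apply: ler_sum => i _.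
rewrite E exprMn sqr_sqrtr; last exact: ltW.
by rewrite mulKf//; exact: lt0r_neq0.
Qed.

End SourceNorm.

(** * Descent of the truncated weighted distance *)

Section Descent.
Context {R : realType} {H : completeNormedModType R} (ip : {dot H for idfun}).
Context (b : nat -> H) (PK : probability nat R).
Hypothesis ipE : inner_norm ip.
Hypothesis pb : prebasis b.
Hypothesis Kinf : infinite_set [set k : nat | PK [set k] != 0%E].
Context {d : measure_display} {T : measurableType d} {P : probability T R}.
Context (K : nat -> {RV P >-> nat}) (v : nat -> nat -> {RV P >-> borel H}).
Context (c : R).
Hypothesis c0 : 0 < c.
Local Notation M := (batch c).
Hypothesis iid : iid_draws K v M PK (direction_law ip b PK).
Context (Risk : H -> R) (alpha : nat -> R) (h1 : H).
Hypothesis dR : forall h : H, differentiable (Risk : H -> R^o) h.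
Local Notation e := (gram_schmidt ip b).
Local Notation L1 f := (P.-integrable setT (EFin \o f)).
Local Notation t := (tail PK).
Local Notation gam i := (cond_mean_tail PK t i.+1).
Local Notation past := (past K v M).
Local Notation hn := (fgfd K v M t alpha Risk h1).
Local Notation ghat := (fgfd_grad K v M t alpha Risk h1).
Local Notation g n w := (gradient ip Risk (hn n w)).
Context (N : nat) (h : H).
Hypothesis g2 : forall n, (n < N)%N -> L1 (fun w => `|g n w| ^+ 2).
Local Notation u n w := (hn n w - h).

Let eo : orthonormal_seq ip e := gs_orthonormal ipE pb.
Let ec : complete_seq ip e := gs_complete ipE pb.

Lemma fgfd_gradient_estimate n : ghat n = estimate ip K v M t n (fun w => g n w).
Proof. by apply/funext => w; rewrite (fgfd_gradE ipE eo ec). Qed.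

Lemma gradient_past_batch n : @weakly_measurable R H ip _ (past n) setT (fun w => g n w).
Proof. exact: (gradient_past ipE eo ec t alpha h1 dR). Qed.

Lemma estimate_measurable n :
  weakly_measurable ip setT (estimate ip K v M t n (fun w => g n w)).
Proof.
rewrite -fgfd_gradient_estimate; exact: (fgfd_grad_measurable ipE eo ec K v M t alpha h1 dR).
Qed.

Lemma gap_past n : @weakly_measurable R H ip _ (past n) setT (fun w => u n w).
Proof.
move=> x; under eq_fun do rewrite ipDr.
apply: measurable_funD => //; exact: (fgfd_past ipE eo ec t alpha h1 dR).
Qed.

Lemma gap_measurable n : weakly_measurable ip setT (fun w => u n w).
Proof. move=> x; exact: (past_measurable_fun (@gap_past n x)). Qed.

Lemma gradient_measurable n : weakly_measurable ip setT (fun w => g n w).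
Proof. move=> x; exact: (past_measurable_fun (@gradient_past_batch n x)). Qed.

Let norm_subr2 (x y : H) : `|x - y| ^+ 2 <= 2 * `|x| ^+ 2 + 2 * `|y| ^+ 2.
Proof.
have := ler_normB x y; have := normr_ge0 (x - y).
have := normr_ge0 x; have := normr_ge0 y.
have := sqr_ge0 (`|x| - `|y|).
nra.
Qed.

Lemma estimate_norm_L2 n : (n < N)%N -> L1 (fun w => `|ghat n w| ^+ 2).
Proof.
move=> nN; rewrite fgfd_gradient_estimate.
exact: (estimate_L2 ipE pb Kinf c0 iid (@gradient_past_batch n) (g2 nN) (@estimate_measurable n)).
Qed.

(** Makes each coordinate of the gap an admissible past factor in [estimate_mean]. The induction
    rests on the bound of the squared norm of a difference by twice both squared norms. *)
Lemma gap_L2 n : (n <= N)%N -> L1 (fun w => `|u n w| ^+ 2).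
Proof.
elim: n => [_|n IH nN].
  apply: (@integrable_dom _ _ _ _ _ (cst (`|h1 - h| ^+ 2))) => //.
  - by apply: (weakly_measurable_norm2 ipE ec); exact: gap_measurable.
  - by move=> w; rewrite ger0_norm ?sqr_ge0.
  - exact: finite_measure_integrable_cst.
apply: (@integrable_dom _ _ _ _ _ (fun w => 2 * `|u n w| ^+ 2 + 2 * alpha n ^+ 2 * `|ghat n w| ^+ 2)).
- apply: (weakly_measurable_norm2 ipE ec); exact: gap_measurable.
- move=> w; rewrite ger0_norm ?sqr_ge0//=.
  have := norm_subr2 (u n w) (alpha n *: ghat n w).
  by rewrite normrZ exprMn real_normK ?num_real// !mulrA addrAC.
- apply: integrable_RD; apply: integrable_Rscale; first exact: IH (ltnW nN).
  exact: estimate_norm_L2.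
Qed.

(* Truncating the weighted norm of [h_n - h] avoids proving that the iterates stay in the
   range of [C^(1/2)]. *)
Definition truncated_gap L n w : R := \sum_(i < L) (gam i)^-1 * ip (e i) (u n w) ^+ 2.

Let gap_coord_L2 n i : (n <= N)%N -> L1 (fun w => ip (e i) (u n w) ^+ 2).
Proof.
move=> nN; apply: integrable_dom (gap_L2 nN).
  by apply: measurable_funX; exact: gap_measurable.
by move=> w; rewrite ger0_norm ?sqr_ge0//; exact: (coord_sq_le ipE pb).
Qed.

Lemma truncated_gap_L1 L n : (n <= N)%N -> L1 (truncated_gap L n).
Proof.
move=> nN; apply: (integrable_Rsum (index_enum 'I_L)
  (fun i : 'I_L => integrable_Rscale (gam i)^-1 (gap_coord_L2 i nN))).1.
Qed.

(** In the cross term the weight 1 / gamma_i cancels the gamma_i of [estimate_mean], so an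
    unweighted scalar product remains. *)
Lemma truncated_gap_step L n : (n < N)%N ->
  \int[P]_w truncated_gap L n.+1 w <= \int[P]_w truncated_gap L n w
   - 2 * alpha n * (\sum_(i < L) \int[P]_w (ip (e i) (g n w) * ip (e i) (u n w)))
   + alpha n ^+ 2 * ((1 + 4 * c) * \int[P]_w (`|g n w| ^+ 2)).
Proof.
move=> nN.
have V := estimate_variance ipE pb Kinf c0 iid (@gradient_past_batch n) (g2 nN)
  (@estimate_measurable n) L.
have D i := estimate_mean ipE pb Kinf c0 iid (@gradient_past_batch n) (g2 nN)
  (@estimate_measurable n) i (@gap_past n (e i)) (gap_coord_L2 i (ltnW nN)).
rewrite -fgfd_gradient_estimate in V D.
set X := fun w => \sum_(i < L) (gam i)^-1 * ip (e i) (ghat n w) ^+ 2 in V.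
pose Y w := \sum_(i < L) (gam i)^-1 * (ip (e i) (ghat n w) * ip (e i) (u n w)).
have [iY EY] := integrable_Rsum (index_enum 'I_L)
  (fun i : 'I_L => integrable_Rscale (gam i)^-1 (D i).1).
have E : truncated_gap L n.+1 = fun w => truncated_gap L n w + (- 2 * alpha n * Y w + alpha n ^+ 2 * X w).
  apply/funext => w; rewrite /truncated_gap /X /Y !mulr_sumr -!big_split/=.
  apply: eq_bigr => i _.
  rewrite addrAC -/(ghat n w) ipDr ipNr ipZr.
  by ring.
have iA := integrable_Rscale (- 2 * alpha n) iY.
have iB := integrable_Rscale (alpha n ^+ 2) V.1.
rewrite E RintegralD//; [|exact: truncated_gap_L1 (ltnW nN)|exact: integrable_RD].
rewrite -addrA lerD2l RintegralD//.
rewrite !RintegralZl//; last exact: V.1.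
rewrite mulNr mulNr lerD//; last by rewrite ler_wpM2l ?sqr_ge0//; exact: V.2.
rewrite lerN2 /Y EY.
under [in leRHS]eq_bigr => i _.
  rewrite RintegralZl//; last exact: (D i).1.
  rewrite (D i).2 mulKf; last by rewrite gt_eqF// cond_mean_gt0.
  over.
by [].
Qed.

Lemma descent_truncated C L :
  (\sum_(i < L) (gam i)^-1 * ip (e i) (h1 - h) ^+ 2 <= C) ->
  2 * \sum_(n < N) alpha n * (\sum_(i < L) \int[P]_w (ip (e i) (g n w) * ip (e i) (u n w)))
  <= C + (1 + 4 * c) * \sum_(n < N) alpha n ^+ 2 * \int[P]_w (`|g n w| ^+ 2).
Proof.
move=> hC.
have Q0 : 0 <= \int[P]_w truncated_gap L N w.
  apply: Rintegral_ge0 => w _; apply: sumr_ge0 => i _.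
  by rewrite mulr_ge0 ?sqr_ge0// invr_ge0 ltW// cond_mean_gt0.
(* The final potential is kept on the left during the induction and dropped at the end, being
   nonnegative. *)
suff S n : (n <= N)%N -> \int[P]_w truncated_gap L n w +
    2 * \sum_(j < n) alpha j * (\sum_(i < L) \int[P]_w (ip (e i) (g j w) * ip (e i) (u j w)))
    <= C + (1 + 4 * c) * \sum_(j < n) alpha j ^+ 2 * \int[P]_w (`|g j w| ^+ 2).
  by apply: le_trans (S N (leqnn N)); rewrite lerDr.
elim: n => [_|n IH nN].
  rewrite !big_ord0 !mulr0 !addr0 /truncated_gap/= Rintegral_cst//.
  by rewrite [fine _](congr1 fine (probability_setT P)) mulr1.
have := IH (ltnW nN); have := truncated_gap_step L nN.
rewrite !big_ord_recr/=; lra.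
Qed.

Lemma gradient_gap_cvg n : (n < N)%N ->
  L1 (fun w => ip (g n w) (u n w)) /\
  \sum_(i < L) \int[P]_w (ip (e i) (g n w) * ip (e i) (u n w)) @[L --> \oo] -->
  (\int[P]_w ip (g n w) (u n w) : R).
Proof.
move=> nN.
have gL2 i : L1 (fun w => ip (e i) (g n w) ^+ 2).
  exact: (coord_L2 ipE pb (@gradient_past_batch n) (g2 nN) i).
have iD i : L1 (fun w => ip (e i) (g n w) * ip (e i) (u n w)).
  apply: integrable_mul_sq; [exact: gradient_measurable|exact: gap_measurable| |].
    exact: gL2.
  exact: gap_coord_L2 (ltnW nN).
have iS L := integrable_Rsum (index_enum 'I_L) (fun i : 'I_L => iD i).
(* By Bessel this majorant serves all truncations [L] at once. *)
have dom : L1 (fun w => `|g n w| ^+ 2 + `|u n w| ^+ 2).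
  by apply: integrable_RD; [exact: g2|exact: gap_L2 (ltnW nN)].
have mip : measurable_fun setT (fun w => ip (g n w) (u n w)).
  by apply: (weakly_measurable_ip ipE ec); [exact: gradient_measurable|exact: gap_measurable].
have bnd L w : `|\sum_(i < L) ip (e i) (g n w) * ip (e i) (u n w)| <= `|g n w| ^+ 2 + `|u n w| ^+ 2.
  apply: le_trans (lerD (bessel ipE eo L (g n w)) (bessel ipE eo L (u n w))).
  rewrite -big_split/=; apply: le_trans (ler_norm_sum _ _ _) _.
  apply: ler_sum => i _; set x := ip _ _; set y := ip _ _.
  rewrite ler_norml; apply/andP.
  have := sqr_ge0 (x - y); have := sqr_ge0 (x + y).
  have := sqr_ge0 x; have := sqr_ge0 y.
  by split; nra.
have lim w : \sum_(i < L) ip (e i) (g n w) * ip (e i) (u n w) @[L --> \oo] --> (ip (g n w) (u n w) : R).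
  exact: (parseval_ip ipE ec).
split.
  apply: integrable_dom dom => // w.
  apply: (ler_cvg_to (cvg_norm (lim w)) (cvg_cst (`|g n w| ^+ 2 + `|u n w| ^+ 2))).
  by apply: nearW => L; exact: bnd.
under eq_fun do rewrite -(iS _).2.
apply: (@dominated_Rconvergence _ _ _ _ _ _ (fun w => `|g n w| ^+ 2 + `|u n w| ^+ 2)) => //.
- by move=> L; exact: L1_measurable (iS L).1.
- exact: aeW.
Qed.

Lemma descent C :
  (forall L, \sum_(i < L) (gam i)^-1 * ip (e i) (h1 - h) ^+ 2 <= C) ->
  2 * \sum_(n < N) alpha n * \int[P]_w ip (g n w) (u n w)
  <= C + (1 + 4 * c) * \sum_(n < N) alpha n ^+ 2 * \int[P]_w (`|g n w| ^+ 2).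
Proof.
move=> hC; set rhs := C + _.
have lim : 2 * \sum_(n < N) alpha n * (\sum_(i < L) \int[P]_w (ip (e i) (g n w) * ip (e i) (u n w)))
    @[L --> \oo] --> 2 * \sum_(n < N) alpha n * \int[P]_w ip (g n w) (u n w).
  apply: cvgMr; apply: (cvg_big add_continuous) => n _; apply: cvgMr.
  exact: (gradient_gap_cvg (ltn_ord n)).2.
apply: (ler_cvg_to lim (cvg_cst rhs)); apply: nearW => L.
exact: descent_truncated.
Qed.

End Descent.

(** * Conclusion by convexity *)

Section Monotone.
Context d (T : measurableType d) (R : realType) (mu : {measure set T -> \bar R}).

(** [f] is not assumed integrable, so its positive and negative parts are compared with those of [x]
    separately, in the extended reals. *)
Lemma integral_le_integrable (f x : T -> R) : measurable_fun setT f ->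
  mu.-integrable setT (EFin \o x) -> (forall w, f w <= x w) ->
  (\int[mu]_w (f w)%:E <= (\int[mu]_w x w)%:E)%E.
Proof.
move=> mf ix fx; rewrite fineK; last exact: integrable_fin_num.
have mx : measurable_fun setT (EFin \o x) by case/integrableP: ix.
have mf' : measurable_fun setT (EFin \o f) by exact/measurable_EFinP.
rewrite integralE [leRHS]integralE; apply: leeB; apply: ge0_le_integral => //.
- exact: measurable_funepos.
- exact: measurable_funepos.
- by move=> w _; apply: (@funepos_le _ _ setT) => [z _|]; rewrite ?inE// lee_fin.
- exact: measurable_funeneg.
- exact: measurable_funeneg.
- by move=> w _; apply: (@funeneg_le _ _ setT) => [z _|]; rewrite ?inE// lee_fin.
Qed.

End Monotone.

Theorem theorem3 (R : realType) (H : completeNormedModType R)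
    (ip : {dot H for idfun}) (b : nat -> H) (Risk : H -> R)
    (PK : probability nat R)
    (d : measure_display) (T : measurableType d) (P : probability T R)
    (K : nat -> {RV P >-> nat}) (v : nat -> nat -> {RV P >-> borel H})
    (c : R) (alpha : nat -> R) (N : nat) (h1 : H) :
  let e := gram_schmidt ip b in
  let t := tail PK in
  let lam := t in
  let M := fun k : nat => `|Num.ceil (k%:R / c : R)|%N in
  let gam := fun i : nat => cond_mean_tail PK lam i.+1 in
  let rangeC := [set diag_pow ip e gam (2^-1) h
                | h in diag_pow_dom ip e gam (2^-1)] in
  let normC := fun h : H => `|diag_pow ip e gam (- 2^-1) h| in
  let hn := fgfd K v M lam alpha Risk h1 in
  let ghat := fgfd_grad K v M lam alpha Risk h1 in
  let g := fun (n : nat) (w : T) => gradient ip Risk (hn n w) in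
  let S := \sum_(n < N) alpha n in
  let hhat := fun w : T => S^-1 *: \sum_(n < N) alpha n *: hn n w in
  inner_norm ip ->
  prebasis b ->
  convex_function (setT : set (convex_lmodType H)) (Risk : H -> R^o) ->
  (forall h : H, differentiable (Risk : H -> R^o) h) ->
  PK [set 0%N] = 0%E ->
  infinite_set [set k : nat | PK [set k] != 0%E] ->
  iid_draws K v M PK (direction_law ip b PK) ->
  0 < c ->
  (forall n : nat, 0 < alpha n) ->
  (0 < N)%N ->
  rangeC h1 ->
  (forall n : nat, (n < N)%N ->
     ('E_P[fun w => (normC (ghat n w) ^+ 2)%R] < +oo)%E) ->
  forall h : H, rangeC h ->
  ('E_P[Risk \o hhat] - (Risk h)%:E <=
   (2^-1 * normC (h - h1) ^+ 2 / S)%:E +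
   ((1 + 2 * c) / S)%:E *
     \sum_(n < N) (alpha n ^+ 2)%:E * 'E_P[fun w => (`|g n w| ^+ 2)%R])%E.
Proof.
move=> e t lam M gam rangeC normC hn ghat g S hhat ipE pb cf df _ Kinf iid c0 a0 N0 rh1 _ h rh.
have eo : orthonormal_seq ip e := gs_orthonormal ipE pb.
have ec : complete_seq ip e := gs_complete ipE pb.
have iid' : iid_draws K v (batch c) PK (direction_law ip b PK) := iid.
have S0 : 0 < S.
  rewrite /S (bigD1 (Ordinal N0))//= ltr_wpDr//.
  by apply: sumr_ge0 => i _; exact: ltW.
have gradP x y : 'd (Risk : H -> R^o) x y = ip (gradient ip Risk x) y.
  exact: (gradientP ipE eo ec).
have mg n : weakly_measurable ip setT (g n).
  by move=> x; exact: (@past_measurable_fun R H d T P K v M n _ (@gradient_past R H ip ipE e eo ec d T P K v M lam alpha Risk h1 df n x)).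
have mg2 n : measurable_fun setT (fun w => `|g n w| ^+ 2).
  exact: (weakly_measurable_norm2 ipE ec (mg n)).
have coef : 0 < (1 + 2 * c) / S by rewrite divr_gt0// addr_gt0// mulr_gt0.
have [g2|] := pselect (forall n, (n < N)%N -> P.-integrable setT (EFin \o (fun w => `|g n w| ^+ 2))); last first.
  move=> /existsNP[n0 /not_implyP[nN ng2]].
  have gy : (\int[P]_w (`|g n0 w| ^+ 2)%:E = +oo)%E.
    apply/eqP/negPn/negP => gy; apply: ng2; apply/integrableP; split.
      exact/measurable_EFinP.
    under eq_integral do rewrite /= ger0_norm ?sqr_ge0//.
    by rewrite ltey.
  rewrite [X in (_ <= _ + _ * X)%E](_ : _ = +oo%E); last first.
    apply/eqP; rewrite esum_eqy.
      apply/existsP; exists (Ordinal nN) => /=.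
      by rewrite unlock gy gt0_muley// lte_fin exprn_gt0.
    move=> i _; rewrite gt_eqF// (lt_le_trans (ltNyr 0))// mule_ge0//.
      by rewrite lee_fin sqr_ge0.
    by rewrite unlock; apply: integral_ge0 => w _; rewrite lee_fin sqr_ge0.
  by rewrite gt0_muley ?lte_fin// addey// leey.
pose u n w := hn n w - h.
pose A n := \int[P]_w ip (g n w) (u n w).
(* An integrable majorant of the risk at the average: Jensen's inequality followed by the tangent
   inequality at each iterate, evaluated at [h]. *)
pose X w := Risk h + S^-1 * \sum_(n < N) alpha n * ip (g n w) (u n w).
have iA n : (n < N)%N -> P.-integrable setT (EFin \o (fun w => ip (g n w) (u n w))).
  by move=> nN; exact: (gradient_gap_cvg ipE pb Kinf c0 iid' df h g2 nN).1.
have [iS ES] := integrable_Rsum (index_enum 'I_N)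
  (fun n : 'I_N => integrable_Rscale (alpha n) (iA n (ltn_ord n))).
have iSS := integrable_Rscale S^-1 iS.
have ic : P.-integrable setT (EFin \o (fun _ : T => Risk h)).
  exact: finite_measure_integrable_cst.
have iX : P.-integrable setT (EFin \o X) by exact: integrable_RD.
have EX : \int[P]_w X w = Risk h + S^-1 * \sum_(n < N) alpha n * A n.
  rewrite RintegralD// RintegralZl// ES Rintegral_cst//.
  rewrite [fine _](congr1 fine (probability_setT P)) mulr1; congr (_ + _ * _).
  by apply: eq_bigr => n _; rewrite RintegralZl//; exact: iA.
have mh : weakly_measurable ip setT hhat.
  move=> x; rewrite /hhat; under eq_fun do rewrite ipZr ip_sumr.
  apply: measurable_funM => //; apply: measurable_sum => n.
  under eq_fun do rewrite ipZr.
  apply: measurable_funM => //.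
  exact: (@past_measurable_fun R H d T P K v M n _ (@fgfd_past R H ip ipE e eo ec d T P K v M lam alpha Risk h1 df n x)).
have cR : continuous Risk by move=> y; exact: differentiable_continuous (df y).
have fX w : Risk (hhat w) <= X w.
  apply: le_trans (convex_jensen cf df gradP (fun n => hn n w) (fun n => ltW (a0 n)) S0) _.
  rewrite -/S.
  apply: (@le_trans _ _ (S^-1 * \sum_(n < N) alpha n * (Risk h + ip (g n w) (u n w)))).
    rewrite ler_wpM2l ?invr_ge0 ?(ltW S0)//; apply: ler_sum => n _.
    rewrite ler_wpM2l ?(ltW (a0 n))//.
    have := convex_gradient_le cf df gradP (hn n w) h.
    by rewrite -opprB ipNr lerBlDr.
  under eq_bigr do rewrite mulrDr.
  by rewrite big_split/= -mulr_suml -/S mulrDr mulKf// gt_eqF.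
have EE : ('E_P[Risk \o hhat] <= (\int[P]_w X w)%:E)%E.
  rewrite unlock; apply: integral_le_integrable => //.
  exact: (weakly_measurable_comp ec cR mh).
have Eg n : (n < N)%N -> 'E_P[fun w => (`|g n w| ^+ 2)%R]%E = (\int[P]_w (`|g n w| ^+ 2))%:E.
  by move=> nN; rewrite unlock fineK//; apply: integrable_fin_num => //; exact: g2.
under eq_bigr => n _ do rewrite (Eg n (ltn_ord n)) -EFinM.
rewrite sumEFin -EFinM -EFinD leeBlDr//.
apply: (le_trans EE); rewrite -EFinD lee_fin EX.
have hC L : \sum_(i < L) (gam i)^-1 * ip (e i) (h1 - h) ^+ 2 <= normC (h - h1) ^+ 2.
  apply: le_trans (source_norm_ge ipE eo ec (cond_mean_gt0 Kinf) L rh1 rh).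
  by apply: ler_sum => i _; rewrite -(opprB h1 h) ipNr sqrrN.
have desc := descent ipE pb Kinf c0 iid' df g2 hC.
rewrite -/(A _) in desc.
set C := normC _ ^+ 2 in hC desc *.
set D := \sum_(n < N) alpha n * A n in desc *.
set E := \sum_(n < N) alpha n ^+ 2 * _ in desc *.
have E0 : 0 <= E.
  apply: sumr_ge0 => n _; rewrite mulr_ge0 ?sqr_ge0//.
  by apply: Rintegral_ge0 => w _; exact: sqr_ge0.
rewrite addrC lerD2r.
have -> : 2^-1 * C / S + (1 + 2 * c) / S * E = S^-1 * (2^-1 * C + (1 + 2 * c) * E).
  by field; rewrite gt_eqF.
rewrite ler_wpM2l ?invr_ge0 ?(ltW S0)//.
(* [desc] is halved: the coefficient of [E] becomes 1/2 + 2 c, and [E0] permits raising it to 1 + 2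
   c. *)
lra.
Qed.
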